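(* Let $G$ be a $\emptyset$-definable group, $M$ a model, $M^*\succ M$ a monster model, $G=G(M^* )$, and let $\mathcal E=\{\varphi_i(x,y,\bar z_i):i\in I,\ \bar z_i\}$ be a $\bigvee$-definable family defining an equivalence relation $E$ on $G$. Assume that $E_M$ is $G(M)$-invariant. The following conditions are equivalent: \begin{enumerate} \item $S_{G/E_M}(M)$ carries a $G(M)$-invariant, Borel probability measure. \item There is a $G(M)$-invariant $G$-pre-mean for $\mathcal E_M$ [equivalently: there is a $G$-invariant $G$-pre-mean for $\mathcal E_M$]. \item The lattice $\mathcal D_{\mathcal E_M}$ carries a $G(M)$-invariant, normalized mean [equivalently: it carries a $G$-invariant, normalized mean]. \end{enumerate}
   Context: A monster model is $\kappa$-saturated and strongly $\kappa$-homogeneous for a sufficiently large $\kappa$; small means of cardinality $<\kappa$; $M$ is small. Definable sets are with parameters from $M^*$; type-definable sets are over small parameter sets. A $\bigvee$-definable family is $\mathcal E=\{\varphi_i(x,y,\bar z_i):i\in I,\ \bar z_i\text{ from any model}\}$ with $\varphi_i$ formulas over $\emptyset$, each implying $x,y\in G$; $I$ is a directed set such that for $i<j$, for every $\bar z_i$ there is $\bar z_j$ such that $\varphi_j(x,y,\bar z_j)$ implies $\varphi_i(x,y,\bar z_i)$. Put $\mathcal E_M=\{\varphi_i(x,y,\bar b_i):i\in I,\ \bar b_i\subseteq M\}$ and $E_M=\bigcap\mathcal E_M$. $\mathcal E$ defines an equivalence relation if for every model $M$, $E_M$ is an ($M$-type-definable) equivalence relation on $G$. $E_M$ is $G(M)$-invariant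 if $(a,b)\in E_M$ implies $(ga,gb)\in E_M$ for $g\in G(M)$; then $G(M)$ acts on $S_{G/E_M}(M)$, the compact space of complete types over $M$ of elements of $G/E_M$ (orbits of $\mathrm{Aut}(M^*/M)$ on $G/E_M$, with the quotient topology from $S_G(M)$). For $R\subseteq G\times G$, $Y\subseteq G$ and $g\in G$: $R\circ Y=\{x\in G:\exists y\in Y\ R(y,x)\}$ and $gR=\{(ga,gb):(a,b)\in R\}$. A $G$-pre-mean for $\mathcal E_M$ is a monotone function $m$ from definable (with parameters) subsets of $G$ into $[0,1]$ with $m(\emptyset)=0$, $m(G)=1$, $m(Y\cup Y')\leq m(Y)+m(Y')$, such that equality holds whenever $\bigl((g_1\varphi_i(x,y,\bar b_1)\cap\dots\cap g_n\varphi_i(x,y,\bar b_n))\circ Y\bigr)\cap Y'=\emptyset$ for some $g_1,\dots,g_n\in G$, $i\in I$, and $\bar b_1,\dots,\bar b_n$ from $M$. $\mathcal D_{\mathcal E_M}$ is the lattice (closed under left $G$-translations) of type-definable (with parameters) subsets $D$ of $G$ such that $(g_1E_M\cap\dots\cap g_nE_M)\circ D=D$ for some $g_1,\dots,g_n\in G$. A normalized mean on a lattice $L$ of subsets of $G$ is a monotone $\rho:L\to[0,1]$ with $\rho(\emptyset)=0$, $\rho(G)=1$, $\rho(Y\cup Y')=\rho(Y)+\rho(Y')-\rho(Y\cap Y')$. Invariance is with respect to left translations by $G(M)$, respectively $G$. *)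

(* Defs.v *)
From HB Require Import structures.
From mathcomp Require Import all_boot all_order all_algebra all_fingroup.
From mathcomp Require Import all_classical all_reals all_analysis.

Set Implicit Arguments.
Unset Strict Implicit.
Unset Printing Implicit Defensive.

Import Order.TTheory GRing.Theory Num.Theory.

Local Open Scope classical_set_scope.
Local Open Scope card_scope.

Record language := Language {
  fsymb : Type;
  farity : fsymb -> nat;
  rsymb : Type;
  rarity : rsymb -> nat }.

Inductive term (L : language) (V : Type) : Type :=
| Var of V
| App (f : fsymb L) of 'I_(farity f) -> term L V.

(* [V] is the type of free variables; the variable bound by [All] is [None].
   Formulas over a parameter set [A] with free variables in [V] are formulas
   over [V + A], the variables in [A] being valued by the inclusion. *)
Inductive formula (L : language) (V : Type) : Type :=
| Eq of term L V & term L V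
| Rel (r : rsymb L) of 'I_(rarity r) -> term L V
| Bot
| Imp of formula L V & formula L V
| All of formula L (option V).

Record structure (L : language) := Structure {
  carrier :> Type;
  carrier_inh : inhabited carrier;
  finterp : forall f : fsymb L, ('I_(farity f) -> carrier) -> carrier;
  rinterp : forall r : rsymb L, ('I_(rarity r) -> carrier) -> Prop }.

Fixpoint eval (L : language) (N : structure L) (V : Type) (v : V -> N)
    (t : term L V) : N :=
  match t with
  | Var x => v x
  | App f ts => finterp (fun i => eval v (ts i))
  end.

Fixpoint sat (L : language) (N : structure L) (V : Type) (phi : formula L V) :
    (V -> N) -> Prop :=
  match phi with
  | Eq s t => fun v => eval v s = eval v t
  | Rel r ts => fun v => rinterp (fun i => eval v (ts i))
  | Bot => fun _ => False
  | Imp f g => fun v => sat f v -> sat g v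
  | All f => fun v => forall a : N, sat f (oapp v a)
  end.

Definition neg (L : language) (V : Type) (phi : formula L V) : formula L V :=
  Imp phi (Bot L V).

Definition vjoin (N V W : Type) (u : V -> N) (v : W -> N) (x : V + W) : N :=
  match x with inl y => u y | inr z => v z end.

Section Models.
Context (L : language) (N : structure L).

(* [M], a subset of [N], is the universe of an elementary substructure *)
Definition elementary_submodel (M : set N) : Prop :=
  exists (M0 : structure L) (j : M0 -> N),
    (forall (k : nat) (phi : formula L 'I_k) (v : 'I_k -> M0),
       sat phi v <-> sat phi (j \o v))
    /\ M = range j.

Definition automorphism (s : N -> N) : Prop :=
  [/\ bijective s,
      forall (f : fsymb L) (v : 'I_(farity f) -> N),
        s (finterp v) = finterp (s \o v) &
      forall (r : rsymb L) (v : 'I_(rarity r) -> N),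
        rinterp v <-> rinterp (s \o v)].

Definition automorphism_over (A : set N) (s : N -> N) : Prop :=
  automorphism s /\ forall a, A a -> s a = a.

Definition sat_over (A : set N) (V : Type) (phi : formula L (V + A))
    (v : V -> N) : Prop :=
  sat phi (vjoin v (fun a : A => val a)).

Definition realizes (A : set N) (V : Type) (v : V -> N)
    (p : set (formula L (V + A))) : Prop :=
  forall phi, p phi -> sat_over phi v.

(* Consistency with the elementary diagram of [N] over [A] is expressed as
   finite satisfiability in [N]. *)
Definition complete_type (A : set N) (V : Type)
    (p : set (formula L (V + A))) : Prop :=
  (forall q, q `<=` p -> finite_set q -> exists v, realizes v q) /\
  (forall phi, p phi \/ p (neg phi)).

(* kappa is the cardinality of [K], and [small K A] is |A| < kappa *)
Definition small (K T : Type) (A : set T) : Prop :=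
  (A #<= [set: K]) /\ ~ ([set: K] #<= A).

Definition saturated (K : Type) : Prop :=
  forall A : set N, small K A ->
  forall (k : nat) (p : set (formula L ('I_k + A))), complete_type p ->
  exists v, realizes v p.

(* only the restriction of [f] to [A] matters *)
Definition elementary_map (A : set N) (f : N -> N) : Prop :=
  forall (k : nat) (phi : formula L 'I_k) (v : 'I_k -> N),
    (forall i, A (v i)) -> sat phi v <-> sat phi (f \o v).

Definition strongly_homogeneous (K : Type) : Prop :=
  forall (A : set N) (f : N -> N), small K A -> elementary_map A f ->
  exists2 s, automorphism s & forall a, A a -> s a = f a.

(* "kappa sufficiently large" is: kappa is uncountable and exceeds the
   cardinality of the language. *)
Definition monster (K : Type) : Prop :=
  [/\ small K [set: nat], small K [set: fsymb L], small K [set: rsymb L],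
      saturated K & strongly_homogeneous K].

Definition definable (A : set N) (V : Type) (Y : set (V -> N)) : Prop :=
  exists phi : formula L (V + A), Y = [set v | sat_over phi v].

End Models.

Section DefinableGroup.
Context (L : language) (N : structure L) (n : nat).
(* The group [G(N)] is an abstract group [G] whose elements are identified with
   [n]-tuples from [N] by [c]. *)
Context (G : groupType) (c : G -> 'I_n -> N).

Definition definable_group : Prop :=
  [/\ injective c,
      definable set0 (range c) &
      definable set0
        (range (fun xy : G * G =>
           vjoin (vjoin (c xy.1) (c xy.2)) (c (xy.1 * xy.2)%g)))].

Definition Gpoints (M : set N) : set G := [set g | forall i, M (c g i)].

Definition Gdefinable_over (A : set N) (Y : set G) : Prop :=
  definable A (c @` Y).

Definition Gdefinable (Y : set G) : Prop := Gdefinable_over [set: N] Y.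

Definition Gtype_definable (K : Type) (Y : set G) : Prop :=
  exists2 A : set N, small K A &
  exists2 F : set (set G), F `<=` Gdefinable_over A & Y = \bigcap_(Z in F) Z.

Definition ltrans (g : G) (Y : set G) : set G := [set (g * x)%g | x in Y].

Definition ltrans_rel (g : G) (R : set (G * G)) : set (G * G) :=
  [set (g * xy.1, g * xy.2)%g | xy in R].

Definition rel_comp (R : set (G * G)) (Y : set G) : set G :=
  [set x | exists2 y, Y y & R (y, x)].

Definition equivalence_on_G (E : set (G * G)) : Prop :=
  [/\ forall x, E (x, x),
      forall x y, E (x, y) -> E (y, x) &
      forall x y z, E (x, y) -> E (y, z) -> E (x, z)].

Definition rel_invariant (H : set G) (E : set (G * G)) : Prop :=
  forall g a b, H g -> E (a, b) -> E (g * a, g * b)%g.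

Section QuotientTypes.
Context (M : set N) (E : set (G * G)).

(* [p] concentrates on [G] if it contains a formula implying that its realizing
   tuple lies in [G]. *)
Definition Gtypes : set (set (formula L ('I_n + M))) :=
  [set p | complete_type p /\
     exists2 phi, p phi & forall v, sat_over phi v -> range c v].

Definition Gtype_space : Type := Gtypes.

HB.instance Definition _ := Choice.on Gtype_space.

Definition basic_clopen (phi : formula L ('I_n + M)) : set Gtype_space :=
  [set p | val p phi].

HB.instance Definition _ := isSubBaseTopological.Build Gtype_space
  (range basic_clopen) id.

Definition eclass (a : G) : set G := [set b | E (a, b)].

Definition aut_image (s : N -> N) (C : set G) : set G :=
  [set b | exists2 a, C a & c b = s \o c a].

Definition orbit_set (a : G) : set (set G) :=
  [set aut_image s (eclass a) | s in automorphism_over M].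

Definition quotient_types : Type := range orbit_set.

HB.instance Definition _ := Choice.on quotient_types.

Definition orbit_of (a : G) : quotient_types :=
  exist _ (orbit_set a) (mem_set (imageT orbit_set a)).

HB.instance Definition _ := isPointed.Build quotient_types (orbit_of 1%g).

(* The default value of [xget] is never used when [N] is a monster model and
   [M] is small; if moreover [E] is invariant under automorphisms over [M],
   the result does not depend on the chosen realization. *)
Definition type_proj (p : Gtype_space) : quotient_types :=
  orbit_of (xget 1%g [set a | realizes (c a) (val p)]).

Definition qtypes_open (U : set quotient_types) : Prop :=
  open (type_proj @^-1` U).

Lemma qtypes_openT : qtypes_open setT.
Proof. by rewrite /qtypes_open preimage_setT; exact: openT. Qed.

Lemma qtypes_openI : setI_closed qtypes_open.
Proof.
by move=> U V oU oV; rewrite /qtypes_open preimage_setI; exact: openI.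
Qed.

Lemma qtypes_open_bigcup (I : Type) (f : I -> set quotient_types) :
  (forall i, qtypes_open (f i)) -> qtypes_open (\bigcup_i f i).
Proof.
move=> of_; rewrite /qtypes_open preimage_bigcup.
by apply: bigcup_open => i _; exact: of_.
Qed.

HB.instance Definition _ := isOpenTopological.Build quotient_types
  qtypes_openT qtypes_openI qtypes_open_bigcup.

Definition borel_quotient_types := g_sigma_algebraType (@open quotient_types).

Definition act_types (g : G) (B : set quotient_types) : set quotient_types :=
  [set o' | exists2 o, B o & val o' = [set ltrans g C | C in val o]].

Definition invariant_probability (R : realType)
    (mu : probability borel_quotient_types R) : Prop :=
  forall (g : G) (B : set borel_quotient_types),
    Gpoints M g -> measurable B -> mu (act_types g B) = mu B.

End QuotientTypes.

Section OrDefinable.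
Context (d : Order.disp_t) (I : porderType d) (k : I -> nat).
(* variables of [phi i]: first the tuples x and y, then the parameters z_i *)
Context (phi : forall i, formula L ('I_n + 'I_n + 'I_(k i))).

Definition instance_rel (i : I) (b : 'I_(k i) -> N) : set (G * G) :=
  [set xy | sat (phi i) (vjoin (vjoin (c xy.1) (c xy.2)) b)].

Definition or_definable_family : Prop :=
  [/\ inhabited I,
      forall i j : I, exists2 l : I, (i <= l)%O & (j <= l)%O,
      forall i (x y : 'I_n -> N) b,
        sat (phi i) (vjoin (vjoin x y) b) -> range c x /\ range c y &
      forall i j : I, (i < j)%O ->
        forall b : 'I_(k i) -> N, exists b' : 'I_(k j) -> N,
          instance_rel b' `<=` instance_rel b].

Definition family_rel (M : set N) : set (G * G) :=
  [set xy | forall i (b : 'I_(k i) -> N),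
     (forall t, M (b t)) -> instance_rel b xy].

(* "every model" ranges over the small elementary submodels of [N] *)
Definition defines_equivalence (K : Type) : Prop :=
  forall M : set N, elementary_submodel M -> small K M ->
    equivalence_on_G (family_rel M).

Context (R : realType).
Local Open Scope ring_scope.

(* Only the values of [m] on definable sets are constrained, and similarly for
   means on a lattice below. *)
Definition G_pre_mean (M : set N) (m : set G -> R) : Prop :=
  [/\ forall Y, Gdefinable Y -> 0 <= m Y <= 1,
      forall Y Y', Gdefinable Y -> Gdefinable Y' -> Y `<=` Y' -> m Y <= m Y',
      m set0 = 0 /\ m setT = 1,
      forall Y Y', Gdefinable Y -> Gdefinable Y' ->
        m (Y `|` Y') <= m Y + m Y' &
      forall Y Y', Gdefinable Y -> Gdefinable Y' ->
        (exists (r : nat) (g : 'I_r.+1 -> G) (i : I)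
                (b : 'I_r.+1 -> 'I_(k i) -> N),
           (forall j t, M (b j t)) /\
           rel_comp (\bigcap_j ltrans_rel (g j) (instance_rel (b j))) Y
             `&` Y' = set0) ->
        m (Y `|` Y') = m Y + m Y'].

Definition D_lattice (K : Type) (M : set N) : set (set G) :=
  [set D | Gtype_definable K D /\
     exists (r : nat) (g : 'I_r.+1 -> G),
       rel_comp (\bigcap_j ltrans_rel (g j) (family_rel M)) D = D].

End OrDefinable.

Local Open Scope ring_scope.

Definition normalized_mean (R : realType) (Lat : set (set G))
    (rho : set G -> R) : Prop :=
  [/\ forall Y, Lat Y -> 0 <= rho Y <= 1,
      forall Y Y', Lat Y -> Lat Y' -> Y `<=` Y' -> rho Y <= rho Y',
      rho set0 = 0 /\ rho setT = 1 &
      forall Y Y', Lat Y -> Lat Y' ->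
        rho (Y `|` Y') = rho Y + rho Y' - rho (Y `&` Y')].

Definition left_invariant (R : realType) (H : set G) (Lat : set (set G))
    (m : set G -> R) : Prop :=
  forall g Y, H g -> Lat Y -> m (ltrans g Y) = m Y.

End DefinableGroup.

(* Main.v *)
(* Means from pre-means: [rho D] is the infimum of [m Z] over the definable
   [Z] containing [D]. Compactness separates disjoint saturated type-definable
   sets by definable sets on which [m] is additive, and modularity follows as for
   regular contents on compact spaces.

   Measures from means: closed subsets of the space of types correspond to
   [E_M]-saturated [M]-type-definable sets, so a mean restricts to a content on
   the closed sets of a compact normal space; its inner content on open sets
   generates an outer measure for which open sets are measurable.

   Pre-means from measures: for [M]-definable [Z] let [m0 Z] be the measure of
   the image of [Z], which is closed. [m0] is additive on pairs of [E_M]-separated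
   sets and [G(M)]-invariant, hence invariant under every element of [G] once
   extended: by Tarski-Vaught there is an ultrafilter on the maps [s : N -> M]
   along which every first-order property of parameters from [N] eventually holds
   of their images, and [m Z] is the limit of [m0] on the [M]-definable sets
   obtained by moving the parameters of [Z] by [s]. *)

Require Import Defs.
From HB Require Import structures.
From mathcomp Require Import all_boot all_order all_algebra all_fingroup.
From mathcomp Require Import all_classical all_reals all_analysis.
From mathcomp Require Import lra.

Set Implicit Arguments.
Unset Strict Implicit.
Unset Printing Implicit Defensive.

Import Order.TTheory GRing.Theory Num.Theory.
Import numFieldNormedType.Exports.

Local Open Scope classical_set_scope.

(** * Definable sets *)

Section Formulas.
Context (L : language).

(** The tension throughout is that [E_M] is invariant only under [G(M)], whereas pre-means and the
    lattice allow finite intersections of translates by arbitrary elements of [G]. On the side of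
    means, a finite list of translating elements is carried along and their coordinates join the
    parameters; two lists are concatenated, which only refines the equivalence relation. On the side
    of measures only the untranslated relation is visible. Moving the parameters removes the
    discrepancy: the translating elements land in [G(M)], so every translated relation contains
    [E_M] again, while the parameters of the formulas already lie in [M] and must stay there; hence
    [s] is required to fix [M] pointwise. The additivity clause of a pre-mean allows a single index
    and parameters from [M], so separation has to end in one such relation. Directedness of the
    family alone yields parameters in [N]; elementarity brings them back to [M]. *)

Fixpoint trename (V W : Type) (f : V -> W) (t : term L V) : term L W :=
  match t with
  | Var x => Var L (f x)
  | App _ ts => App (fun i => trename f (ts i))
  end.

Fixpoint rename (V : Type) (phi : formula L V) : forall W, (V -> W) -> formula L W :=
  match phi with
  | Eq s t => fun W f => Eq (trename f s) (trename f t)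
  | Rel _ ts => fun W f => Rel (fun i => trename f (ts i))
  | Bot => fun W _ => Bot L W
  | Imp p q => fun W f => Imp (rename p f) (rename q f)
  | All p => fun W f => All (rename p (omap f))
  end.

Lemma eval_trename (N : structure L) (V W : Type) (f : V -> W) (v : W -> N)
    (t : term L V) : Defs.eval v (trename f t) = Defs.eval (v \o f) t.
Proof. by elim: t => //= g ts IH; congr finterp; apply/funext. Qed.

Lemma sat_rename (N : structure L) (V : Type) (phi : formula L V) (W : Type)
    (f : V -> W) (v : W -> N) : sat (rename phi f) v <-> sat phi (v \o f).
Proof.
elim: phi W f v => /= [U s t|U r ts|U|U p IHp q IHq|U p IHp] W f v.
- by rewrite !eval_trename.
- by under eq_fun do rewrite eval_trename.
- by [].
- by split=> pq /IHp /pq /IHq.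
- have oE a : oapp v a \o omap f = oapp (v \o f) a by apply/funext => -[].
  by split=> H a; have := H a; rewrite IHp oE.
Qed.

Lemma term_support (V : Type) (t : term L V) :
  exists2 S : set V, finite_set S & forall (N : structure L) (v w : V -> N),
    (forall x, S x -> v x = w x) -> Defs.eval v t = Defs.eval w t.
Proof.
elim: t => [x|g ts IH].
  by exists [set x] => [|N v w vw]; [exact: finite_set1|exact: vw].
have /(_ _)/cid2-/all_sig2[S fS SE] := IH.
exists (\bigcup_i S i) => [|N v w vw /=]; first exact: bigcup_finite.
by congr finterp; apply/funext => i; apply: SE => x Sx; apply: vw; exists i.
Qed.

(** Saturation and elementarity are stated for finitely many variables, while formulas below may
    have all of [N] as variables; finite support bridges the two. It is uniform in the structure
    because the Tarski-Vaught argument evaluates one formula in both [M0] and [N]. *)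
Lemma formula_support (V : Type) (phi : formula L V) :
  exists2 S : set V, finite_set S & forall (N : structure L) (v w : V -> N),
    (forall x, S x -> v x = w x) -> (sat phi v <-> sat phi w).
Proof.
elim: phi => /= [U s t|U r ts|U|U p [S fS SE] q [S' fS' SE']|U p [S fS SE]].
- have [[S fS SE] [S' fS' SE']] := (term_support s, term_support t).
  exists (S `|` S') => [|N v w vw]; first by rewrite finite_setU.
  by rewrite (SE _ v w) ?(SE' _ v w)// => x Sx; apply: vw; [right|left].
- have /(_ _)/cid2-/all_sig2[S fS SE] := fun i => term_support (ts i).
  exists (\bigcup_i S i) => [|N v w vw /=]; first exact: bigcup_finite.
  suff -> : (fun i => Defs.eval v (ts i)) = (fun i => Defs.eval w (ts i)) by [].
  by apply/funext => i; apply: SE => x Sx; apply: vw; exists i.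
- by exists set0.
- exists (S `|` S') => [|N v w vw]; first by rewrite finite_setU.
  have Sp := SE _ v w (fun x Sx => vw x (or_introl Sx)).
  have Sq := SE' _ v w (fun x Sx => vw x (or_intror Sx)).
  by split=> pq /Sp/pq/Sq.
- exists (Some @^-1` S) => [|N v w vw].
    by apply: finite_preimage => // x y _ _ [].
  have Sa a : sat p (oapp v a) <-> sat p (oapp w a).
    by apply: SE => -[x|]//= /vw.
  by split=> H a; apply/Sa.
Qed.

Lemma finite_index (V : Type) (S : set V) : inhabited V -> finite_set S ->
  exists k (f : 'I_k -> V) (idx : V -> 'I_k), forall x, S x -> f (idx x) = x.
Proof.
move=> [x0] /(@finite_seqP {classic V})[l ->].
(* The [.+1] keeps the index type inhabited when [S] is empty; the extra index points to the default
   [x0]. *)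
exists (size l).+1, (fun i => nth x0 l i),
  (fun x => inord (index (x : {classic V}) l)) => x /= xl.
rewrite (@inordK (size l)); first exact: (@nth_index {classic V}).
by rewrite ltnS (@index_size {classic V}).
Qed.

Lemma sat_all_block (V : Type) (k : nat) (phi : formula L (V + 'I_k)) :
  exists psi : formula L V, forall (N : structure L) (v : V -> N),
    sat psi v <-> forall w, sat phi (vjoin v w).
Proof.
elim: k V phi => [|k IH] V phi.
  pose g (x : V + 'I_0) := match x with inl y => y | inr (Ordinal _ i) => False_rect V (notF i) end.
  exists (rename phi g) => N v; rewrite sat_rename.
  have gE w : v \o g = vjoin v w by apply/funext => -[//|[]].
  by split=> [+ w|/(_ (fun i => v (g (inr i))))]; rewrite -gE.
(* The outermost quantifier binds index 0; the other indices are shifted down for the induction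
   hypothesis. *)
pose g (x : V + 'I_k.+1) : option V + 'I_k := match x with
  | inl y => inl (Some y)
  | inr i => oapp inr (inl None) (unlift ord0 i) end.
have [psi psiE] := IH _ (rename phi g).
exists (All psi) => N v /=.
have gE a w : vjoin (oapp v a) w \o g =
    vjoin v (fun i => oapp w a (unlift ord0 i)).
  by apply/funext => -[//|i]/=; case: unliftP.
split=> [H w|H a].
  have /psiE/(_ (w \o lift ord0)) := H (w ord0); rewrite sat_rename gE.
  congr sat; congr vjoin; apply/funext => i /=.
  by case: unliftP => [j|] ->.
by apply/psiE => w; rewrite sat_rename gE.
Qed.

End Formulas.

Section Definability.
Context (L : language) (N : structure L).
Implicit Types (A B : set N) (V W : Type).

Lemma definable_eq A V (P Q : set (V -> N)) :
  (forall v, P v <-> Q v) -> definable A P -> definable A Q.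
Proof. by move=> PQ; rewrite (_ : P = Q)//; apply/seteqP; split=> v /PQ. Qed.

Lemma definableP A V (Y : set (V -> N)) : definable A Y <->
  exists phi : formula L (V + A), forall v, Y v <-> sat_over phi v.
Proof.
split=> [[phi ->]|[phi E]]; exists phi => //.
by apply/seteqP; split=> v /E.
Qed.

Lemma definable_sat A V W (phi : formula L W) (f : W -> V) :
  definable A [set v | sat phi (fun x => v (f x))].
Proof.
by apply/definableP; exists (rename phi (inl \o f)) => v; rewrite /sat_over sat_rename.
Qed.

Lemma definable_preim A V W (Y : set (W -> N)) (f : W -> V) :
  definable A Y -> definable A [set v | Y (fun x => v (f x))].
Proof.
move=> /definableP[phi YE]; apply/definableP.
exists (rename phi (fun x => match x with inl y => inl (f y) | inr a => inr a end)).
move=> v; rewrite /sat_over sat_rename /=; apply: iff_trans (YE _) _.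
rewrite /sat_over (_ : _ \o _ = vjoin (fun x => v (f x)) val)//.
by apply/funext => -[].
Qed.

Lemma definable_param A V W (Y : set (V + W -> N)) (w : W -> N) :
  (forall x, A (w x)) -> definable A Y -> definable A [set v | Y (vjoin v w)].
Proof.
move=> Aw /definableP[phi YE]; apply/definableP.
exists (rename phi (fun x => match x with
  | inl (inl y) => inl y | inl (inr z) => inr (exist _ (w z) (mem_set (Aw z)))
  | inr a => inr a end)).
move=> v; rewrite /sat_over sat_rename /=; apply: iff_trans (YE _) _.
rewrite /sat_over (_ : _ \o _ = vjoin (vjoin v w) val)//.
by apply/funext => -[[]|].
Qed.

Lemma definable_sub A B V (Y : set (V -> N)) :
  A `<=` B -> definable A Y -> definable B Y.
Proof.
move=> AB /definableP[phi YE]; apply/definableP.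
exists (rename phi (fun x => match x with inl y => inl y
  | inr a => inr (exist _ (val a) (mem_set (AB _ (set_mem (valP a))))) end)).
move=> v; rewrite /sat_over sat_rename /=; apply: iff_trans (YE _) _.
rewrite /sat_over (_ : _ \o _ = vjoin v val)//.
by apply/funext => -[].
Qed.

Lemma definable_finite V (Y : set (V -> N)) : definable [set: N] Y ->
  exists2 B : set N, finite_set B & definable B Y.
Proof.
move=> /definableP[phi YE]; have [S fS SE] := formula_support phi.
have [a0] := carrier_inh N.
(* Parameters outside the support must still name an element of [B]; they are sent to [a0]. *)
pose B := a0 |` [set val a | a in inr @^-1` S].
have Ba0 : B a0 by left.
exists B.
  rewrite finite_setU; split; first exact: finite_set1.
  by apply: finite_image; apply: finite_preimage => // x y _ _ [].
pose g (x : V + [set: N]) : V + B := match x with inl y => inl y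
  | inr a => match pselect (B (val a)) with
    | left Ba => inr (exist _ (val a) (mem_set Ba))
    | right _ => inr (exist _ a0 (mem_set Ba0)) end end.
apply/definableP; exists (rename phi g) => v; apply: iff_trans (YE _) _.
rewrite /sat_over sat_rename; apply: SE => -[//|a] Sa /=.
by case: pselect => // -[]; right; exists a.
Qed.

Section Closure.
Context (A : set N) (V : Type).
Implicit Types P Q : set (V -> N).

Lemma definableT : definable A [set _ : V -> N | True].
Proof.
by apply/definableP; exists (Imp (Bot L _) (Bot L _)) => v; rewrite /sat_over; split=> [_|_]/=.
Qed.

Lemma definable_imp P Q : definable A P -> definable A Q ->
  definable A [set v | P v -> Q v].
Proof.
move=> /definableP[p pE] /definableP[q qE]; apply/definableP.
exists (Imp p q) => v; rewrite /sat_over /=.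
by split=> [pq /pE/pq/qE|pq /pE/pq/qE].
Qed.

Lemma definable_not P : definable A P -> definable A [set v | ~ P v].
Proof.
move=> /definableP[p pE]; apply/definableP; exists (neg p) => v.
by split=> [pq /pE|pq /pE].
Qed.

Lemma definable_or P Q : definable A P -> definable A Q ->
  definable A [set v | P v \/ Q v].
Proof.
move=> dP dQ; apply: definable_eq (definable_imp (definable_not dP) dQ) => v.
split=> /= [PQ|[p /(_ p)|q _]]//.
by have [|/PQ] := pselect (P v); [left|right].
Qed.

Lemma definable_and P Q : definable A P -> definable A Q ->
  definable A [set v | P v /\ Q v].
Proof.
move=> dP dQ.
apply: definable_eq (definable_not (definable_imp dP (definable_not dQ))) => v.
by split=> [/=/not_implyP[? /contrapT]|[p q] /(_ p)].
Qed.

Lemma definable_iff P Q : definable A P -> definable A Q ->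
  definable A [set v | P v <-> Q v].
Proof. by move=> dP dQ; apply: definable_and; apply: definable_imp. Qed.

Lemma definable_all k (Y : set (V + 'I_k -> N)) : definable A Y ->
  definable A [set v | forall w, Y (vjoin v w)].
Proof.
move=> /definableP[phi YE]; apply/definableP.
pose g (x : V + 'I_k + A) : V + A + 'I_k := match x with
  | inl (inl y) => inl (inl y) | inl (inr i) => inr i | inr a => inl (inr a) end.
have [psi psiE] := sat_all_block (rename phi g); exists psi => v.
rewrite /sat_over psiE.
have gE w : vjoin (vjoin v val) w \o g = vjoin (vjoin v w) val
  by apply/funext => -[[]|].
by split=> [H w|H w]; have := H w; rewrite YE sat_rename gE.
Qed.

Lemma definable_forall_seq (J : eqType) (s : seq J) (Y : J -> set (V -> N)) :
  (forall j, j \in s -> definable A (Y j)) ->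
  definable A [set v | forall j, j \in s -> Y j v].
Proof.
elim: s => [|j s IH] dY.
  by apply: definable_eq definableT => v; split=> // _ j; rewrite in_nil.
have dYs : definable A [set v | forall i, i \in s -> Y i v].
  by apply: IH => i si; apply: dY; rewrite in_cons si orbT.
apply: definable_eq (definable_and (dY j (mem_head j s)) dYs) => v; split=> [[Yj Ys] i|H].
  by rewrite in_cons => /orP[/eqP->|/Ys].
by split=> [|i si]; apply: H; rewrite in_cons ?eqxx// si orbT.
Qed.

Lemma definable_forall_fin (J : finType) (Y : J -> set (V -> N)) :
  (forall j, definable A (Y j)) -> definable A [set v | forall j, Y j v].
Proof.
move=> dY; apply: definable_eq (definable_forall_seq (s := enum J) (fun j _ => dY j)) => v.
split=> /= Yv j; last by move=> _; exact: Yv.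
by apply: Yv; rewrite mem_enum.
Qed.

Lemma definable_var_eq (x y : V) : definable A [set v | v x = v y].
Proof.
exact: (@definable_sat A V bool (Eq (Var L true) (Var L false))
  (fun b => if b then x else y)).
Qed.

End Closure.

Lemma definable_ex A V k (Y : set (V + 'I_k -> N)) : definable A Y ->
  definable A [set v | exists w, Y (vjoin v w)].
Proof.
move=> dY.
apply: definable_eq (definable_not (definable_all (definable_not dY))) => v.
split=> /= [/existsNP[w /contrapT Yw]|[w Yw] /(_ w)//].
by exists w.
Qed.

(** * Tarski-Vaught, and moving parameters into an elementary submodel *)

Section Elementary.
Context (M : set N) (hM : elementary_submodel M).

Lemma tarski_vaught (k : nat) (Y : set ('I_k -> N)) : definable M Y ->
  Y !=set0 -> exists2 w, Y w & forall i, M (w i).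
Proof.
have [M0 [j [elem ME]]] := hM.
have MS : M `<=` range j by rewrite ME.
(* Elementarity for arbitrary variable types: variables are first renamed to their values in [M0],
   an inhabited type, and then indexed by a finite support. *)
have elemV V (phi : formula L V) (v : V -> M0) : sat phi v <-> sat phi (j \o v).
  have [S fS SE] := formula_support (rename phi v).
  have [q [f [idx fK]]] := finite_index (carrier_inh M0) fS.
  have E (N' : structure L) (u : M0 -> N') :
      sat phi (u \o v) <-> sat (rename (rename phi v) idx) (u \o f).
    rewrite -sat_rename (sat_rename (rename phi v) idx).
    by apply: SE => x Sx /=; rewrite fK.
  by apply: iff_trans (E _ id) (iff_trans (elem _ _ _) (iff_sym (E _ j))).
have /(_ _)/cid-/all_sig[h hE] : forall a : M, exists y, j y = val a.
  by move=> a; have [y _ <-] := MS _ (set_mem (valP a)); exists y.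
move=> /definableP[phi YE] [w0 Yw0].
pose swp (x : 'I_k + M) : M + 'I_k := match x with inl i => inr i | inr a => inl a end.
(* [psi] says that [Y] is empty, the parameters from [M] being its variables. It is false in [N],
   hence in [M0]. *)
have [psi psiE] := sat_all_block (rename (neg phi) swp).
have swpE N' (v : M -> N') w : vjoin v w \o swp = vjoin w v by apply/funext => -[].
have : ~ sat psi h.
  rewrite elemV psiE => /(_ w0); rewrite sat_rename swpE => /=; apply.
  rewrite (_ : _ \o h = val); first exact/YE.
  exact/funext.
rewrite psiE => /existsNP[w]; rewrite sat_rename swpE => /= /contrapT.
rewrite elemV => Yw; exists (j \o w) => [|i]; last by rewrite ME; exists (w i).
apply/YE; rewrite /sat_over (_ : vjoin _ _ = j \o vjoin w h)//.
by apply/funext => -[//|a] /=; rewrite hE.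
Qed.

(** A formula whose variables are the elements of [N] is a property of maps [s : N -> N], and [P id]
    asserts it of the elements themselves. Those in [M] stay as parameters; for the finitely many
    others that occur, Tarski-Vaught finds values in [M]. *)
Lemma specialization (P : set (N -> N)) : definable set0 P -> P id ->
  exists s, [/\ P s, forall x, M (s x) & forall x, M x -> s x = x].
Proof.
move=> /definableP[phi PE] Pid.
have [S fS SE] := formula_support phi.
have fS' : finite_set (inl @^-1` S) by apply: finite_preimage => // x y _ _ [].
have [k [f [idx fK]]] := finite_index (carrier_inh N) fS'.
pose g (x : N) : 'I_k + M := match pselect (M x) with
  | left Mx => inr (exist _ x (mem_set Mx)) | right _ => inl (idx x) end.
(* Every [x] outside [M] goes through [idx], even if it does not occur in the formula, so [ext w]
   takes all its values in [M] as soon as [w] does. *)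
pose ext (w : 'I_k -> N) : N -> N := fun x => vjoin w val (g x).
have dY : definable M [set w | P (ext w)].
  apply/definableP.
  have /definableP[psi psiE] := definable_preim g (definable_sub (@sub0set _ M) (ex_intro _ phi erefl)).
  exists (rename psi (fun x => match x with inl y => y | inr a => inr a end)) => w.
  rewrite /sat_over sat_rename (_ : _ \o _ = vjoin (vjoin w val) val); last by apply/funext => -[].
  exact: iff_trans (PE _) (psiE _).
have [|w Pw Mw] := tarski_vaught dY.
  exists f => /=; apply/PE; rewrite /sat_over -(SE _ (vjoin id val)); first exact/PE.
  by move=> [x|[? ?]]//= Sx; rewrite /ext /g; case: pselect => //= _; rewrite fK.
exists (ext w); split=> // x; rewrite /ext /g.
  by case: pselect => /=.
by case: pselect => /=.
Qed.

End Elementary.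
End Definability.

(** * Cardinalities *)

Section Cardinals.
Local Open Scope card_scope.

Lemma card_le_rel (T U : Type) (A : set T) (B : set U) (r : T -> U -> Prop) :
  (forall x, A x -> exists2 y, B y & r x y) ->
  (forall x x' y, A x -> A x' -> r x y -> r x' y -> x = x') -> A #<= B.
Proof.
move=> totr injr.
have /(_ _)/cid-/all_sig[f fr] : forall x : A, exists y : B, r (val x) (val y).
  move=> x; have [y By rxy] := totr _ (set_mem (valP x)).
  by exists (exist _ y (mem_set By)).
apply/card_leP/injfunPex; exists f => // x x' _ _ fE; apply: val_inj.
have := fr x'; rewrite -fE; apply: injr (fr x); apply: set_mem; exact: valP.
Qed.

Lemma card_le_fun (T : Type) (U : pointedType) (A : set T) (B : set U) :
  A #<= B -> exists2 f : T -> U, set_fun A B f & set_inj A f.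
Proof. by move=> /pcard_leP/injfunPex. Qed.

(** Zorn's lemma on partial injections from [A] to [B]: a maximal one that is neither total nor onto
    could be extended by one pair. *)
Lemma card_le_total (T U : Type) (A : set T) (B : set U) :
  A #<= B \/ B #<= A.
Proof.
pose P (F : set (T * U)) :=
  [/\ forall p, F p -> A p.1 /\ B p.2,
      forall x y y', F (x, y) -> F (x, y') -> y = y' &
      forall x x' y, F (x, y) -> F (x', y) -> x = x'].
have [|F [[FAB Ff Fi] maxF]] := @Zorn_bigcup _ P.
  move=> C CP totC; split=> [p [F /CP[+ _ _]]|x y y'|x x' y]; first exact.
  - move=> [F CF Fy] [F' CF' Fy'].
    have [FF'|F'F] := totC _ _ CF CF'.
      by have [_ + _] := CP _ CF'; move=> /(_ _ _ _ (FF' _ Fy) Fy').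
    by have [_ + _] := CP _ CF; move=> /(_ _ _ _ Fy (F'F _ Fy')).
  - move=> [F CF Fy] [F' CF' Fy'].
    have [FF'|F'F] := totC _ _ CF CF'.
      by have [_ _] := CP _ CF'; move=> /(_ _ _ _ (FF' _ Fy) Fy').
    by have [_ _] := CP _ CF; move=> /(_ _ _ _ Fy (F'F _ Fy')).
have [AF|/existsNP[a /not_implyP[Aa Fa]]] :=
    pselect (forall x, A x -> exists2 y, B y & F (x, y)).
  by left; apply: card_le_rel AF _ => x x' y _ _; exact: Fi.
have [BF|/existsNP[b /not_implyP[Bb Fb]]] :=
    pselect (forall y, B y -> exists2 x, A x & F (x, y)).
  by right; apply: (card_le_rel BF) => y y' x _ _; exact: Ff.
have nFa y : ~ F (a, y) by move=> /[dup] /FAB[_ By] Fay; apply: Fa; exists y.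
have nFb x : ~ F (x, b) by move=> /[dup] /FAB[Ax _] Fxb; apply: Fb; exists x.
exfalso; apply: (maxF (F `|` [set (a, b)])).
  by split=> [p Fp|/(_ (a, b) (or_intror erefl))/nFa//]; left.
split=> [p [/FAB//|->//]|x y y'|x x' y].
- move=> [Fxy|[xa yb]] [Fxy'|[xa' yb']].
  + exact: Ff Fxy Fxy'.
  + by rewrite xa' in Fxy; have := nFa _ Fxy.
  + by rewrite xa in Fxy'; have := nFa _ Fxy'.
  + by rewrite yb yb'.
- move=> [Fxy|[xa yb]] [Fxy'|[xa' yb']].
  + exact: Fi Fxy Fxy'.
  + by rewrite yb' in Fxy; have := nFb _ Fxy.
  + by rewrite yb in Fxy'; have := nFb _ Fxy'.
  + by rewrite xa xa'.
Qed.

(* Zorn's lemma applied to relations [F] sending each point of a set [D] to a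
   pair of points of [D], all these pairs being disjoint; [D] is cofinite in
   [A] when [F] is maximal. *)
Lemma card_setU_le (T : Type) (A B : set T) :
  infinite_set A -> B #<= A -> A `|` B #<= A.
Proof.
move: T A B; elim/Ppointed => [T|T] A B.
  by rewrite (_ : A = set0)// -subset0 => x; have := no x.
move=> infA BA.
pose dom (F : set (T * (T * T))) := [set x | exists p, F (x, p)].
pose P (F : set (T * (T * T))) :=
  (forall p, F p -> [/\ A p.1, dom F p.2.1 & dom F p.2.2]) /\
  (forall p q, F p -> F q -> [/\ p.2.1 <> q.2.2,
     p.2.1 = q.2.1 -> p.1 = q.1 & p.2.2 = q.2.2 -> p.1 = q.1]).
have [|F [[FA Fi] maxF]] := @Zorn_bigcup _ P.
  move=> C CP totC; split=> [p [F CF Fp]|p q [F CF Fp] [F' CF' Fq]].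
    have [+ _] := CP _ CF; move=> /(_ _ Fp)[Ap [u Fu] [v Fv]].
    by split=> //; [exists u|exists v]; exists F.
  have [FF'|F'F] := totC _ _ CF CF'.
    by have [_] := CP _ CF'; apply=> //; exact: FF'.
  by have [_] := CP _ CF; apply=> //; exact: F'F.
pose D := dom F.
have DA : D `<=` A by move=> x [p /FA[]].
have cofD : finite_set (A `\` D).
  apply: contrapT => /infiniteP/card_le_fun[e eAD ei].
  have {}ei i j : e i = e j -> i = j by apply: ei; rewrite inE.
  have nD i : ~ D (e i) by have [] := eAD i I.
  (* An infinite sequence avoiding [D] would extend [F] by sending the i-th term to the terms 2i and
     2i+1; parity keeps first and second components apart. *)
  pose F' := [set p | exists i, p = (e i, (e i.*2, e i.*2.+1))].
  have dom' i : dom (F `|` F') (e i).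
    by eexists; right; exists i.
  have domS x : D x -> dom (F `|` F') x by move=> [p Fp]; exists p; left.
  apply: (maxF (F `|` F')).
    split=> [p Fp|]; first by left.
    move=> /(_ _ (or_intror (ex_intro _ 0%N erefl))) F0.
    by apply: (nD 0%N); eexists; exact: F0.
  split=> [p [/FA[Ap /domS ? /domS ?]//|[i ->]]|p q].
    by split=> //=; have [] := eAD i I.
  have nF1 p' i : F p' -> p'.2.1 <> e i by move=> /FA[_ + _] E; rewrite E; exact: nD.
  have nF2 p' i : F p' -> p'.2.2 <> e i by move=> /FA[_ _ +] E; rewrite E; exact: nD.
  move=> [Fp|[i ->]] [Fq|[j ->]] /=.
  - exact: Fi.
  - by split=> [/nF1|/nF1|/nF2]; exact.
  - by split=> /esym; [move/nF2|move/nF1|move/nF2]; exact.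
  - split=> [/ei /(congr1 odd)|/ei/double_inj->|/ei[/double_inj->]]//.
    by rewrite /= !odd_double.
have infD : infinite_set D.
  by move=> fD; apply: infA; apply: sub_finite_set (_ : A `<=` D `|` (A `\` D)) _;
    [move=> x Ax; have [|] := pselect (D x); [left|right]|rewrite finite_setU].
(* The first components of [F] receive a copy of [X], the second ones a copy of the rest of [Y]. *)
have UD (X Y : set T) : X #<= D -> Y #<= D -> X `|` Y #<= D.
  move=> /card_le_fun[f fD fi] /card_le_fun[g gD gi].
  pose r x y := (X x /\ exists z, F (f x, (y, z))) \/
    (~ X x /\ exists z, F (g x, (z, y))).
  apply: (@card_le_rel _ _ _ _ r) => [x XYx|x x' y].
    have [Xx|nXx] := pselect (X x).
      have [[u v] Fx] := fD _ Xx; exists u; first by have [_ ] := FA _ Fx.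
      by left; split=> //; exists v.
    have Yx : Y x by case: XYx.
    have [[u v] Fx] := gD _ Yx; exists v; first by have [_ ] := FA _ Fx.
    by right; split=> //; exists u.
  move=> XYx XYx' [[Xx [z Fx]]|[nXx [z Fx]]] [[Xx' [z' Fx']]|[nXx' [z' Fx']]].
  - have [_ /(_ erefl)+ _] := Fi _ _ Fx Fx'; by apply: fi; rewrite inE.
  - by have [] := Fi _ _ Fx Fx'.
  - by have [] := Fi _ _ Fx' Fx.
  - have [_ _ /(_ erefl)] := Fi _ _ Fx Fx'.
    by apply: gi; rewrite inE; [case: XYx|case: XYx'].
have ADle : A `\` D #<= D.
  have cD : A `\` D #<= [set: nat] := finite_set_countable cofD.
  by apply: card_le_trans cD _; exact/infiniteP.
have AD : A #<= D.
  suff /subset_card_le/card_le_trans : A `<=` D `|` (A `\` D) by apply; exact: UD.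
  by move=> x Ax; have [|] := pselect (D x); [left|right].
exact: card_le_trans (UD _ _ AD (card_le_trans BA AD)) (subset_card_le DA).
Qed.

Context (K : Type) (K_inf : small K [set: nat]).

Lemma finite_small (T : Type) (A : set T) : finite_set A -> small K A.
Proof.
have [natK nKnat] := K_inf.
move=> /finite_set_countable fA; have {}fA : A #<= [set: nat] := fA; split; first exact: card_le_trans fA natK.
by move=> KA; apply: nKnat; exact: card_le_trans KA fA.
Qed.

Lemma small_setU (T : Type) (A B : set T) :
  small K A -> small K B -> small K (A `|` B).
Proof.
wlog BA : A B / B #<= A => [H|sA sB].
  have [AB|BA] := card_le_total A B; last exact: H.
  by rewrite setUC => sA sB; apply: H.
have [fA|infA] := pselect (finite_set A).
  by apply: finite_small; rewrite finite_setU; split=> //; exact: card_le_finite BA fA.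
have AB := card_setU_le infA BA; have [AK nKA] := sA.
split; first exact: card_le_trans AB AK.
by move=> KAB; apply: nKA; exact: card_le_trans KAB AB.
Qed.

End Cardinals.

(** * Compactness *)

Section Compactness.
Context (L : language) (N : structure L) (K : Type) (hN : monster N K).

(** Compactness in the form used below. Along an ultrafilter extending [F], the formulas over [A]
    that eventually hold of [f] form a complete type, and saturation realizes it. *)
Lemma realize_filter (V : finType) (A : set N) (T : Type) (F : set_system T)
    {FF : ProperFilter F} (f : T -> V -> N) : small K A ->
  exists v, forall Y : set (V -> N), definable A Y -> F (f @^-1` Y) -> Y v.
Proof.
move=> sA; have [U [UU FU]] := ultraFilterLemma FF.
have [_ _ _ satN _] := hN.
pose p : set (formula L ('I_#|V| + A)) :=
  [set psi | U [set t | sat_over psi (fun i => f t (enum_val i))]].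
have [|v vp] := satN _ sA _ p.
  split=> [q qp fq|psi]; last first.
    exact: (in_ultra_setVsetC [set t | sat_over psi (fun i => f t (enum_val i))]).
  have : U (\bigcap_(psi in q) [set t | sat_over psi (fun i => f t (enum_val i))]).
    move: fq => /(@finite_fsetP {classic (formula L ('I_#|V| + A))})[q' qE].
    rewrite qE; apply: (@filter_bigI _ {classic (formula L ('I_#|V| + A))} q' _ U _).
    by move=> psi psiq; apply: qp; rewrite qE.
  by move=> /filter_ex[t tq]; exists (fun i => f t (enum_val i)) => psi; exact: tq.
exists (fun x => v (enum_rank x)) => Y /(definable_preim (@enum_rank V)).
move=> /definableP[psi YE] FY; apply/YE/vp; apply: filterS (FU _ FY) => t.
rewrite /preimage /= => Yt; apply/YE => /=.
by under eq_fun do rewrite enum_rankK.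
Qed.

End Compactness.

(** * Definable and type-definable subsets of the group *)

Section DefinableSubsets.
Context (L : language) (N : structure L) (n : nat) (G : groupType).
Context (c : G -> 'I_n -> N) (hG : definable_group c).

Let c_inj : injective c. Proof. by case: hG. Qed.

Lemma c_imageE (Z : set G) a : (c @` Z) (c a) <-> Z a.
Proof. by split=> [[b Zb /c_inj <-//]|Za]; exists a. Qed.

Definition gmul (u v w : 'I_n -> N) : Prop :=
  exists a b, [/\ u = c a, v = c b & w = c (a * b)%g].

Lemma gmulE a b w : gmul (c a) (c b) w <-> w = c (a * b)%g.
Proof. by split=> [[a' [b' [/c_inj<- /c_inj<-]]]//|->]; exists a, b. Qed.

Lemma gmulVE a w w' : gmul (c a) w w' <-> exists b, w = c (a^-1 * b)%g /\ w' = c b.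
Proof.
split=> [[a' [b [/c_inj<- -> ->]]]|[b [-> ->]]].
  by exists (a * b)%g; rewrite mulKg.
by apply/gmulE; rewrite mulKVg.
Qed.

Section Definable.
Context (A : set N).

Lemma definable_in_G V (f : 'I_n -> V) :
  definable A [set v : V -> N | range c (fun i => v (f i))].
Proof.
by have [_ dG _] := hG; exact/definable_preim/definable_sub/dG.
Qed.

Lemma definable_gmul V (f g h : 'I_n -> V) :
  definable A [set v : V -> N |
    gmul (fun i => v (f i)) (fun i => v (g i)) (fun i => v (h i))].
Proof.
have [_ _ dmul] := hG.
pose s (x : 'I_n + 'I_n + 'I_n) :=
  match x with inl (inl i) => f i | inl (inr i) => g i | inr i => h i end.
apply: definable_eq (definable_preim s (definable_sub (@sub0set _ A) dmul)) => v.
split=> [[[a b] _ /= E]|[a [b [fa gb hab]]]].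
  by exists a, b; split; apply/funext => i;
    [move: (congr1 (@^~ (inl (inl i))) E)|move: (congr1 (@^~ (inl (inr i))) E)|
     move: (congr1 (@^~ (inr i)) E)] => /= ->.
exists (a, b) => //; apply/funext => -[[i|i]|i] /=.
- by move: (congr1 (@^~ i) fa) => /= ->.
- by move: (congr1 (@^~ i) gb) => /= ->.
- by move: (congr1 (@^~ i) hab) => /= ->.
Qed.

Lemma definable_gmul_param V a (f g : 'I_n -> V) : (forall i, A (c a i)) ->
  definable A [set v : V -> N | gmul (c a) (fun i => v (f i)) (fun i => v (g i))].
Proof.
move=> Aa.
exact: (definable_param Aa (definable_gmul inr (inl \o f) (inl \o g))).
Qed.

(** [P] may hold of tuples outside the group; intersecting with the definable range of [c] cuts them
    off. *)
Lemma Gdefinable_overP (Z : set G) (P : set ('I_n -> N)) :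
  (forall a, Z a <-> P (c a)) -> definable A P -> Gdefinable_over c A Z.
Proof.
move=> ZP dP; apply: definable_eq (definable_and (definable_in_G id) dP) => v.
split=> [[[a _ /= va] Pv]|[a /ZP Za <-]]; first by exists a => //; apply/ZP; rewrite va.
by split=> //; exists a.
Qed.

Lemma GdefinableT : Gdefinable_over c A setT.
Proof. exact: Gdefinable_overP (definableT _ _). Qed.

Lemma GdefinableC Z : Gdefinable_over c A Z -> Gdefinable_over c A (~` Z).
Proof.
move=> /definable_not; apply: Gdefinable_overP => a.
by split=> nZ; [move=> /c_imageE|move=> Za; apply: nZ; exact/c_imageE].
Qed.

Lemma Gdefinable0 : Gdefinable_over c A set0.
Proof. by rewrite -setCT; exact/GdefinableC/GdefinableT. Qed.

Lemma GdefinableI Z Z' : Gdefinable_over c A Z -> Gdefinable_over c A Z' ->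
  Gdefinable_over c A (Z `&` Z').
Proof.
move=> dZ dZ'; apply: Gdefinable_overP (definable_and dZ dZ') => a.
by split=> -[]; split; exact/c_imageE.
Qed.

Lemma GdefinableU Z Z' : Gdefinable_over c A Z -> Gdefinable_over c A Z' ->
  Gdefinable_over c A (Z `|` Z').
Proof.
move=> dZ dZ'; apply: Gdefinable_overP (definable_or dZ dZ') => a.
by split=> [[Za|Za]|[/c_imageE|/c_imageE]]; [left|right|left|right] => //;
  exact/c_imageE.
Qed.

Lemma Gdefinable1 a : (forall i, A (c a i)) -> Gdefinable_over c A [set a].
Proof.
move=> Aa.
have d1 i : definable A [set v : 'I_n -> N | v i = c a i].
  exact: (definable_param (fun _ : unit => Aa i)
    (definable_var_eq _ (inl i) (inr tt))).
apply: Gdefinable_overP (definable_forall_fin d1) => b.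
by split=> [-> //|/funext/c_inj].
Qed.

Lemma mem_ltrans g (Z : set G) a : ltrans g Z a <-> Z (g^-1 * a)%g.
Proof.
by split=> [[b Zb <-]|Za]; [rewrite mulKg|exists (g^-1 * a)%g; rewrite ?mulKVg].
Qed.

Lemma Gdefinable_ltrans g Z : (forall i, A (c g i)) ->
  Gdefinable_over c A Z -> Gdefinable_over c A (ltrans g Z).
Proof.
move=> Ag dZ.
have := definable_ex (definable_and
  (definable_gmul_param (V := 'I_n + 'I_n) inr inl Ag) (definable_preim inr dZ)).
apply: Gdefinable_overP => a; rewrite mem_ltrans; split=> [Za|].
  exists (c (g^-1 * a)%g); split; last exact/c_imageE.
  by apply/gmulVE; exists a.
move=> [w [/gmulVE[b [wE /c_inj->]] Zw]]; apply/c_imageE.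
by rewrite -wE.
Qed.

End Definable.

Lemma Gdefinable_sub A B Z : A `<=` B ->
  Gdefinable_over c A Z -> Gdefinable_over c B Z.
Proof. exact: definable_sub. Qed.

Lemma Gdefinable_finite Z : Gdefinable c Z ->
  exists2 B, finite_set B & Gdefinable_over c B Z.
Proof. exact: definable_finite. Qed.

Lemma Gdefinable_over_Gdefinable A Z : Gdefinable_over c A Z -> Gdefinable c Z.
Proof. exact: Gdefinable_sub. Qed.

(** [D] contains the intersection of its [A]-definable supersets, hence equals it. Compared with
    [Gtype_definable], no defining family is chosen and the size of [A] is left open. *)
Definition tdefinable (A : set N) (D : set G) : Prop :=
  forall x, (forall Z, Gdefinable_over c A Z -> D `<=` Z -> Z x) -> D x.

Lemma tdefinable_bigcap A (F : set (set G)) : F `<=` Gdefinable_over c A ->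
  tdefinable A (\bigcap_(Z in F) Z).
Proof. by move=> FA x H Z FZ; apply: H (FA _ FZ) _ => y; apply. Qed.

Lemma tdefinable_def A Z : Gdefinable_over c A Z -> tdefinable A Z.
Proof. by move=> dZ x; apply. Qed.

Lemma tdefinable_sub A B D : A `<=` B -> tdefinable A D -> tdefinable B D.
Proof. by move=> AB tD x H; apply: tD => Z /(Gdefinable_sub AB); exact: H. Qed.

Lemma tdefinableI A D D' :
  tdefinable A D -> tdefinable A D' -> tdefinable A (D `&` D').
Proof.
move=> tD tD' x H; split; [apply: tD|apply: tD'] => Z dZ DZ.
  by apply: H => // y [/DZ].
by apply: H => // y [_ /DZ].
Qed.

Lemma Gtype_definableP K D :
  Gtype_definable c K D <-> exists2 A, small K A & tdefinable A D.
Proof.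
split=> [[A sA [F FA ->]]|[A sA tD]]; exists A => //; first exact: tdefinable_bigcap.
exists [set Z | Gdefinable_over c A Z /\ D `<=` Z]; first by move=> Z [].
by apply/seteqP; split=> [x Dx Z [_]|x H]; [exact|apply: tD => Z dZ DZ; exact: H].
Qed.

End DefinableSubsets.

(** * Saturation under equivalence relations *)

Section Relations.
Context (G : groupType).
Implicit Types (R S : set (G * G)) (Y D : set G).

Lemma ltrans_relE (g : G) R p :
  ltrans_rel g R p <-> R (g^-1 * p.1, g^-1 * p.2)%g.
Proof.
split=> [[[x y] Rxy <-]|Rp]; first by rewrite /= !mulKg.
by exists (g^-1 * p.1, g^-1 * p.2)%g => //=; rewrite !mulKVg; case: p {Rp}.
Qed.

Lemma ltrans_rel1 R : ltrans_rel 1%g R = R.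
Proof.
by apply/seteqP; split=> -[x y]; rewrite -/(ltrans_rel _ _ _) ltrans_relE invg1 /= !mul1g.
Qed.

Lemma rel_compS R S Y D : R `<=` S -> Y `<=` D -> rel_comp R Y `<=` rel_comp S D.
Proof. by move=> RS YD x [y /YD Dy /RS Sx]; exists y. Qed.

Section Equivalence.
Context R (eqR : equivalence_on_G R).

Lemma equivalence_ltrans (g : G) : equivalence_on_G (ltrans_rel g R).
Proof.
have [Rr Rs Rt] := eqR.
by split=> [x|x y|x y z]; rewrite !ltrans_relE => //=; [exact: Rs|exact: Rt].
Qed.

Lemma equivalence_bigcap J (S : J -> set (G * G)) :
  (forall j, equivalence_on_G (S j)) -> equivalence_on_G (\bigcap_j S j).
Proof.
move=> eqS; split=> [x j _|x y Sxy j _|x y z Sxy Syz j _].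
- by have [] := eqS j.
- by have [_ + _] := eqS j; apply; exact: Sxy.
- by have [_ _ +] := eqS j; apply; [exact: Sxy|exact: Syz].
Qed.

Lemma sub_rel_comp Y : Y `<=` rel_comp R Y.
Proof. by have [Rr _ _] := eqR; move=> y Yy; exists y. Qed.

Lemma rel_comp_idem Y : rel_comp R (rel_comp R Y) = rel_comp R Y.
Proof.
have [_ _ Rt] := eqR; apply/seteqP; split; last exact: sub_rel_comp.
by move=> x [y [z Yz Rzy] Ryx]; exists z => //; exact: Rt Rzy Ryx.
Qed.

Lemma saturatedP D : rel_comp R D = D <-> forall x y, D x -> R (x, y) -> D y.
Proof.
split=> [<- x y [z Dz Rzx] Rxy|H].
  by have [_ _ Rt] := eqR; exists z => //; exact: Rt Rzx Rxy.
by apply/seteqP; split; [move=> x [y /H + Ryx]; exact|exact: sub_rel_comp].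
Qed.

Lemma saturatedI D D' : rel_comp R D = D -> rel_comp R D' = D' ->
  rel_comp R (D `&` D') = D `&` D'.
Proof.
move=> /saturatedP H /saturatedP H'; apply/saturatedP => x y [Dx D'x] Rxy.
by split; [exact: H Dx Rxy|exact: H' D'x Rxy].
Qed.

Lemma rel_comp_subC D Y : rel_comp R D = D -> D `<=` ~` Y ->
  D `<=` ~` rel_comp R Y.
Proof.
move=> /saturatedP H DY x Dx [y Yy Ryx]; apply: (DY y) => //.
by have [_ Rs _] := eqR; apply: H Dx _; exact: Rs.
Qed.

End Equivalence.

Lemma saturated_sub R S D : equivalence_on_G R -> equivalence_on_G S -> R `<=` S ->
  rel_comp S D = D -> rel_comp R D = D.
Proof.
move=> eqR eqS RS /(saturatedP eqS) H; apply/(saturatedP eqR) => x y Dx /RS.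
exact: H.
Qed.

End Relations.

(** * Separation of saturated type-definable sets *)

Section Separation.
Context (L : language) (N : structure L) (K : Type) (hN : monster N K).
Context (M : set N) (hM : elementary_submodel M) (sM : small K M).
Context (n : nat) (G : groupType) (c : G -> 'I_n -> N) (hG : definable_group c).
Context (d : Order.disp_t) (I : porderType d) (k : I -> nat).
Context (phi : forall i, formula L ('I_n + 'I_n + 'I_(k i))).
Hypothesis hphi : or_definable_family c phi.

Lemma definable_instance A V i (x y : 'I_n -> V) (z : 'I_(k i) -> V) :
  definable A [set v : V -> N | sat (phi i)
    (vjoin (vjoin (fun t => v (x t)) (fun t => v (y t))) (fun t => v (z t)))].
Proof.
pose s u := match u with inl (inl t) => x t | inl (inr t) => y t | inr t => z t end.
apply: definable_eq (definable_sat A (phi i) s) => v /=.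
suff -> : (fun t => v (s t)) = vjoin (vjoin (fun t => v (x t)) (fun t => v (y t)))
  (fun t => v (z t)) by [].
by apply/funext => -[[]|].
Qed.

(* [(y, x)] belongs to the translate by [g] of [instance_rel b], as a property
   of the tuples [c g], [b], [c y] and [c x]. *)
Definition ltrans_formula i (g : 'I_n -> N) (b : 'I_(k i) -> N) (y x : 'I_n -> N) :=
  exists w w', [/\ gmul c g w y, gmul c g w' x & sat (phi i) (vjoin (vjoin w w') b)].

Lemma ltrans_formulaE i g b y x : @ltrans_formula i (c g) b (c y) (c x) <->
  ltrans_rel g (instance_rel c phi b) (y, x).
Proof.
have [c_inj _ _] := hG.
rewrite ltrans_relE; split=> [[w [w' []]]|yx].
  move=> /(gmulVE hG)[y' [-> /c_inj->]] /(gmulVE hG)[x' [-> /c_inj->]].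
  by rewrite /instance_rel.
exists (c (g^-1 * y)%g), (c (g^-1 * x)%g).
by split=> //; apply/(gmulVE hG); [exists y|exists x].
Qed.

Lemma definable_ltrans_formula A V i (g y x : 'I_n -> V) (b : 'I_(k i) -> V) :
  definable A [set v : V -> N | @ltrans_formula i (fun t => v (g t))
    (fun t => v (b t)) (fun t => v (y t)) (fun t => v (x t))].
Proof.
pose P (v : V + 'I_n + 'I_n -> N) :=
  (gmul c (fun t => v (inl (inl (g t)))) (fun t => v (inl (inr t)))
     (fun t => v (inl (inl (y t)))) /\
   gmul c (fun t => v (inl (inl (g t)))) (fun t => v (inr t))
     (fun t => v (inl (inl (x t))))) /\
  sat (phi i) (vjoin (vjoin (fun t => v (inl (inr t))) (fun t => v (inr t)))
    (fun t => v (inl (inl (b t))))).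
have dP : definable A P.
  apply: definable_and; last exact: definable_instance.
  by apply: definable_and; exact: definable_gmul.
apply: definable_eq (definable_ex (definable_ex dP)) => v.
by split=> [[w [w' [[? ?] ?]]]|[w [w' [? ? ?]]]]; exists w, w'.
Qed.

Lemma definable_ltrans_formula_param A V i (g : 'I_n -> N) (b : 'I_(k i) -> N)
    (y x : 'I_n -> V) : (forall t, A (g t)) -> (forall t, A (b t)) ->
  definable A [set v : V -> N |
    @ltrans_formula i g b (fun t => v (y t)) (fun t => v (x t))].
Proof.
move=> Ag Ab.
have := definable_ltrans_formula A (inl \o inr) (inl \o inl \o y)
  (inl \o inl \o x) (inr : 'I_(k i) -> V + 'I_n + 'I_(k i)).
by move=> /(definable_param Ab)/(definable_param Ag).
Qed.

Definition basic_rel r (g : 'I_r.+1 -> G) i (b : 'I_r.+1 -> 'I_(k i) -> N) :=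
  \bigcap_j ltrans_rel (g j) (instance_rel c phi (b j)).

Lemma Gdefinable_rel_comp A r (g : 'I_r.+1 -> G) i (b : 'I_r.+1 -> 'I_(k i) -> N) Z :
  (forall j t, A (c (g j) t)) -> (forall j t, A (b j t)) ->
  Gdefinable_over c A Z -> Gdefinable_over c A (rel_comp (basic_rel g b) Z).
Proof.
move=> Ag Ab dZ.
have db : definable A [set v : 'I_n + 'I_n -> N | forall j,
    @ltrans_formula i (c (g j)) (b j) (fun t => v (inr t)) (fun t => v (inl t))].
  by apply: definable_forall_fin => j; exact: definable_ltrans_formula_param.
have := definable_ex (definable_and (definable_preim inr dZ) db).
apply: (Gdefinable_overP hG) => x; split=> [[y Zy yx]|[w [Zw wx]]].
  exists (c y); split; first exact/(c_imageE hG).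
  by move=> j /=; apply/ltrans_formulaE; exact: yx.
have {Zw} [y Zy yw] : (c @` Z) w := Zw.
by exists y => // j _; apply/ltrans_formulaE; rewrite yw; exact: (wx j).
Qed.

(** Directedness only gives a parameter in [N]. The inclusion of the two relations is a first-order
    property of it over [M], so Tarski-Vaught replaces it by one in [M]. *)
Lemma instance_dir i l (b : 'I_(k i) -> N) : (i <= l)%O -> (forall t, M (b t)) ->
  exists2 b' : 'I_(k l) -> N, forall t, M (b' t) &
    instance_rel c phi b' `<=` instance_rel c phi b.
Proof.
have [_ _ phiG dirphi] := hphi.
rewrite Order.POrderTheory.le_eqVlt => /orP[/eqP il|il] Mb.
  by case: l / il; exists b.
have [b0 b0b] := dirphi _ _ il b.
pose P (v : 'I_(k l) + 'I_n + 'I_n + 'I_(k i) -> N) :=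
  sat (phi l) (vjoin (vjoin (fun t => v (inl (inl (inr t)))) (fun t => v (inl (inr t))))
     (fun t => v (inl (inl (inl t))))) ->
  sat (phi i) (vjoin (vjoin (fun t => v (inl (inl (inr t)))) (fun t => v (inl (inr t))))
     (fun t => v (inr t))).
have dP : definable M P by apply: definable_imp; exact: definable_instance.
have [|b' b'b Mb'] := tarski_vaught hM
  (definable_all (definable_all (definable_param Mb dP))).
  (* The quantifiers range over all tuples, but [phi l] holds only of tuples from the group, where
     the inclusion is known. *)
  exists b0 => w w' ww'; have [[x _ xE] [y _ yE]] := phiG _ _ _ _ ww'.
  by have := b0b (x, y); rewrite /instance_rel /= xE yE; exact.
by exists b' => // -[x y]; exact: b'b.
Qed.

Context (r : nat) (g : 'I_r.+1 -> G).

Let E' := \bigcap_j ltrans_rel (g j) (family_rel c phi M).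

(* The relations [g_1 phi_i(b_1) /\ ... /\ g_q phi_i(b_q)] with [b_j] from [M];
   they form a filter base whose intersection is [E']. *)
Definition entourage (B : set (G * G)) : Prop :=
  exists q (h : 'I_q.+1 -> G) i (b : 'I_q.+1 -> 'I_(k i) -> N),
    [/\ forall j, exists l, h j = g l, forall j t, M (b j t) & B = basic_rel h b].

Lemma entourage_sub B : entourage B -> E' `<=` B.
Proof.
move=> [q [h [i [b [hg Mb ->]]]]] p Ep j _; have [l hl] := hg j.
have := Ep l Logic.I; rewrite hl !ltrans_relE; apply; exact: Mb.
Qed.

Lemma entourageI B B' : entourage B -> entourage B' ->
  exists2 B'', entourage B'' & B'' `<=` B `&` B'.
Proof.
move=> [q [h [i [b [hg Mb ->]]]]] [q' [h' [i' [b' [hg' Mb' ->]]]]].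
have [_ dirI _ _] := hphi; have [l il i'l] := dirI i i'.
have /(_ _)/cid2-/all_sig2[e Me eb] := fun j => instance_dir il (Mb j).
have /(_ _)/cid2-/all_sig2[e' Me' eb'] := fun j => instance_dir i'l (Mb' j).
(* The two lists of translates are concatenated; [q.+1 + q'.+1] is convertible to [(q + q'.+1).+1],
   the shape that [basic_rel] asks for. *)
pose sp (j : 'I_(q + q'.+1).+1) : 'I_q.+1 + 'I_q'.+1 := fintype.split (j : 'I_(q.+1 + q'.+1)).
exists (basic_rel (fun j => match sp j with inl x => h x | inr x => h' x end)
  (fun j => match sp j with inl x => e x | inr x => e' x end)).
  exists (q + q'.+1)%N; eexists; exists l; eexists; split=> // j.
    by move=> /=; case: (sp j).
  by move=> /=; case: (sp j).
move=> p pE; split=> j _.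
  have := pE (lshift q'.+1 j) Logic.I; rewrite /sp -[lshift _ _]/(unsplit (inl j)) unsplitK.
  by rewrite !ltrans_relE; exact: eb.
have := pE (rshift q.+1 j) Logic.I; rewrite /sp -[rshift _ _]/(unsplit (inr j)) unsplitK.
by rewrite !ltrans_relE; exact: eb'.
Qed.

Lemma entourage1 j i (b : 'I_(k i) -> N) : (forall t, M (b t)) ->
  entourage (ltrans_rel (g j) (instance_rel c phi b)).
Proof.
move=> Mb; exists 0%N, (fun=> g j), i, (fun=> b); split=> //; first by exists j.
by apply/seteqP; split=> [p pb j' _//|p /(_ ord0 Logic.I)].
Qed.

Lemma entourage_ex : exists B, entourage B.
Proof.
have [[i] _ _ _] := hphi; have [M0 [f [_ ME]]] := hM.
have [a] := carrier_inh M0; eexists; apply: (@entourage1 ord0 i (fun=> f a)) => t.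
by rewrite ME; exists a.
Qed.


(** The coordinates of the translating elements, which may lie outside [M]. *)
Definition params : set N := [set x | exists j t, x = c (g j) t].

Lemma params_finite : finite_set params.
Proof.
apply: sub_finite_set (finite_image (fun p : 'I_r.+1 * 'I_n => c (g p.1) p.2)
  (@finite_finset _ [set: 'I_r.+1 * 'I_n])) => x [j [t ->]].
by exists (j, t).
Qed.

(** If no triple worked, the sets of pairs from [Z] and [Z'] related by [B] would generate a proper
    filter, and a pair realizing it would lie in [E'] and join a point of [D] to a point of [D'].
    Such a [B] is exactly what the additivity clause of a pre-mean asks for. *)
Lemma separation A A' D D' : small K A -> small K A' ->
  tdefinable c A D -> tdefinable c A' D' -> rel_comp E' D `&` D' = set0 ->
  exists Z Z' B, [/\ Gdefinable_over c A Z /\ D `<=` Z,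
    Gdefinable_over c A' Z' /\ D' `<=` Z', entourage B &
    rel_comp B Z `&` Z' = set0].
Proof.
move=> sA sA' tD tD' DD'; apply: contrapT => nsep.
pose Q (z : set G * set G * set (G * G)) :=
  [/\ Gdefinable_over c A z.1.1 /\ D `<=` z.1.1,
    Gdefinable_over c A' z.1.2 /\ D' `<=` z.1.2 & entourage z.2].
pose F := filter_from Q (fun z => [set p | [/\ z.1.1 p.1, z.1.2 p.2 & z.2 p]]).
have FF : ProperFilter F.
  apply: filter_from_proper; last first.
    move=> [[Z Z'] B] [/= QZ QZ' QB]; apply: contrapT => E; apply: nsep.
    exists Z, Z', B; split=> //; rewrite -subset0 => x [[y Zy Byx] Z'x].
    by apply: E; exists (y, x).
  apply: filter_from_filter.
    have [B QB] := entourage_ex; exists (setT, setT, B).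
    by split=> //; split=> //; exact: GdefinableT.
  move=> [[Z Z'] B] [[Z1 Z1'] B1] [/= [dZ DZ] [dZ' DZ'] eB] [/= [dZ1 DZ1] [dZ1' DZ1'] eB1].
  have [B2 eB2 B2B] := entourageI eB eB1.
  exists (Z `&` Z1, Z' `&` Z1', B2).
    by split=> //=; (split; first exact: GdefinableI) => x Dx; split;
      [exact: DZ|exact: DZ1|exact: DZ'|exact: DZ1'].
  by move=> [y x] [/= [Zy Z1y] [Z'x Z1'x] /B2B[]].
have [nat_small _ _ _ _] := hN.
pose A0 := A `|` A' `|` M `|` params.
have sA0 : small K A0.
  apply: small_setU (finite_small nat_small params_finite) => //.
  by apply: small_setU => //; exact: small_setU.
have AA0 : A `<=` A0 by move=> a Aa; left; left; left.
have A'A0 : A' `<=` A0 by move=> a Aa; left; left; right.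
have [v vF] := @realize_filter _ _ _ hN ('I_n + 'I_n)%type _ _ F FF
  (fun p => vjoin (c p.1) (c p.2)) sA0.
have [y _ yE] : range c (fun t => v (inl t)).
  apply: (vF _ (definable_in_G hG _ inl)); apply: filterS filterT => p _.
  by exists p.1.
have [x _ xE] : range c (fun t => v (inr t)).
  apply: (vF _ (definable_in_G hG _ inr)); apply: filterS filterT => p _.
  by exists p.2.
have [B0 eB0] := entourage_ex.
have Dy : D y.
  apply: tD => Z dZ DZ; apply/(c_imageE hG); rewrite yE.
  apply: (vF _ (definable_preim inl (definable_sub AA0 dZ))).
  exists (Z, setT, B0); first by split=> //; split=> //; exact: GdefinableT.
  by move=> p [Zp _ _]; exists p.1.
have D'x : D' x.
  apply: tD' => Z dZ DZ; apply/(c_imageE hG); rewrite xE.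
  apply: (vF _ (definable_preim inr (definable_sub A'A0 dZ))).
  exists (setT, Z, B0); first by split=> //; split=> //; exact: GdefinableT.
  by move=> p [_ Zp _]; exists p.2.
suff E'yx : E' (y, x) by rewrite -[False]/(set0 x) -DD'; split=> //; exists y.
move=> j _; rewrite ltrans_relE => i b Mb.
suff : ltrans_rel (g j) (instance_rel c phi b) (y, x) by rewrite ltrans_relE.
apply/ltrans_formulaE; rewrite yE xE.
have := definable_ltrans_formula_param (A := A0) (g := c (g j)) (b := b) (inl : _ -> 'I_n + 'I_n) inr.
move=> /(_ (fun t => or_intror (ex_intro _ j (ex_intro _ t erefl)))
  (fun t => or_introl (or_intror (Mb t))))/vF; apply.
exists (setT, setT, ltrans_rel (g j) (instance_rel c phi b)).
  by split; [split=> //; exact: GdefinableT..|exact: entourage1].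
by move=> [y' x'] [_ _ /= /ltrans_formulaE].
Qed.

Lemma entourage_Gdefinable A B Z : M `<=` A -> params `<=` A -> entourage B ->
  Gdefinable_over c A Z -> Gdefinable_over c A (rel_comp B Z).
Proof.
move=> MA gA [q [h [i [b [hg Mb ->]]]]]; apply: Gdefinable_rel_comp => [j t|j t].
  by have [l ->] := hg j; apply: gA; exists l, t.
exact/MA.
Qed.

(** For a point [x] outside the saturation, separation of [D] from the singleton of [x] yields a
    definable superset [rel_comp B Z] of the saturation that misses [x]. *)
Lemma tdefinable_rel_comp A D : small K A -> tdefinable c A D ->
  tdefinable c (A `|` M `|` params) (rel_comp E' D).
Proof.
move=> sA tD x H; apply: contrapT => nx.
have [nat_small _ _ _ _] := hN.
have sx : small K (range (c x)).
  exact/(finite_small nat_small)/finite_image/finite_finset.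
have tx : tdefinable c (range (c x)) [set x].
  by apply: tdefinable_def; apply: (Gdefinable1 hG) => t; exists t.
have [|Z [Z' [B [[dZ DZ] [_ xZ'] eB BZ]]]] := separation sA sx tD tx.
  by rewrite -subset0 => z [Ez zx]; apply: nx; rewrite -zx.
have : rel_comp B Z x.
  apply: H.
    apply: entourage_Gdefinable eB (Gdefinable_sub _ dZ).
    - by move=> a Ma; left; right.
    - by move=> a ga; right.
    - by move=> a Aa; left; left.
  exact: rel_compS (entourage_sub eB) DZ.
by move=> BZx; rewrite -[False]/(set0 x) -BZ; split=> //; exact: xZ'.
Qed.

End Separation.

(** * From pre-means to means *)

Section PreMeanToMean.
Context (L : language) (N : structure L) (K : Type) (hN : monster N K).
Context (M : set N) (hM : elementary_submodel M) (sM : small K M).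
Context (n : nat) (G : groupType) (c : G -> 'I_n -> N) (hG : definable_group c).
Context (d : Order.disp_t) (I : porderType d) (k : I -> nat).
Context (phi : forall i, formula L ('I_n + 'I_n + 'I_(k i))).
Hypothesis hphi : or_definable_family c phi.
Hypothesis eqE : equivalence_on_G (family_rel c phi M).
Context (R : realType) (m : set G -> R) (hm : G_pre_mean c phi M m).
Local Open Scope ring_scope.

Definition outer_mean (D : set G) : R :=
  inf [set m Z | Z in [set Z | Gdefinable c Z /\ D `<=` Z]].

Let dT : Gdefinable c setT. Proof. exact: GdefinableT. Qed.

Let cover_n0 D : [set m Z | Z in [set Z | Gdefinable c Z /\ D `<=` Z]] !=set0.
Proof. by exists (m setT), setT. Qed.

Let cover_lb D : has_lbound [set m Z | Z in [set Z | Gdefinable c Z /\ D `<=` Z]].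
Proof.
have [m01 _ _ _ _] := hm.
by exists 0 => _ [Z [dZ _] <-]; have /andP[] := m01 _ dZ.
Qed.

Lemma outer_mean_le D Z : Gdefinable c Z -> D `<=` Z -> outer_mean D <= m Z.
Proof. by move=> dZ DZ; apply: ge_inf => //; exists Z. Qed.

Lemma le_outer_mean D x : (forall Z, Gdefinable c Z -> D `<=` Z -> x <= m Z) ->
  x <= outer_mean D.
Proof. by move=> H; apply: lb_le_inf => // _ [Z [dZ DZ] <-]; exact: H. Qed.

Lemma outer_mean_mono D D' : D `<=` D' -> outer_mean D <= outer_mean D'.
Proof.
move=> DD'; apply: le_outer_mean => Z dZ D'Z; apply: outer_mean_le => //.
exact: subset_trans D'Z.
Qed.

Lemma outer_mean_cover D Z D' : Gdefinable c Z -> D `<=` Z `|` D' ->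
  outer_mean D <= m Z + outer_mean D'.
Proof.
have [_ _ _ msub _] := hm; move=> dZ DZD'.
rewrite -lerBlDl; apply: le_outer_mean => Z' dZ' D'Z'; rewrite lerBlDl.
apply: le_trans (msub _ _ dZ dZ'); apply: outer_mean_le; first exact: GdefinableU.
by move=> x /DZD'[|/D'Z']; [left|right].
Qed.

Section Saturated.
Context (r : nat) (g : 'I_r.+1 -> G).

Let E' := \bigcap_j ltrans_rel (g j) (family_rel c phi M).

Let eqE' : equivalence_on_G E'.
Proof. by apply: equivalence_bigcap => j; exact: equivalence_ltrans. Qed.

Let closed_sat D := Gtype_definable c K D /\ rel_comp E' D = D.

Lemma outer_mean_disjoint D D' : closed_sat D -> closed_sat D' ->
  D `&` D' = set0 -> outer_mean D + outer_mean D' <= outer_mean (D `|` D').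
Proof.
have [_ mmono _ _ madd] := hm.
move=> [/Gtype_definableP[A sA tD] ED] [/Gtype_definableP[A' sA' tD'] ED'] DD'.
have [|Z [Z' [B [[dZ DZ] [dZ' D'Z'] eB BZ]]]] :=
  separation hN hM sM hG hphi (g := g) sA sA' tD tD'.
  by rewrite ED.
have {}dZ := Gdefinable_over_Gdefinable dZ.
have {}dZ' := Gdefinable_over_Gdefinable dZ'.
apply: le_outer_mean => W dW DW.
(* The separating sets are unrelated to the cover [W]; intersecting them with [W] keeps them
   separated. *)
have dWZ : Gdefinable c (W `&` Z) by exact: GdefinableI.
have dWZ' : Gdefinable c (W `&` Z') by exact: GdefinableI.
apply: (@le_trans _ _ (m ((W `&` Z) `|` (W `&` Z')))); last first.
  by apply: mmono => //; [exact: GdefinableU|move=> x [[]|[]]].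
have [q [h [i [b [hg Mb BE]]]]] := eB.
rewrite madd//; last first.
  exists q, h, i, b; split=> //; rewrite -/(basic_rel c phi h b) -BE -subset0 => x.
  move=> [[y [_ Zy] Byx] [_ Z'x]]; rewrite -BZ; split=> //; by exists y.
by apply: lerD; apply: outer_mean_le => // x Dx; split;
  [apply: DW; left|exact: DZ|apply: DW; right|exact: D'Z'].
Qed.

(* The witness is [E' o (~ Y) `&` D]: the saturation of the complement of [Y]
   misses the saturated set [S] because [S `<=` Y]. *)
Lemma outer_mean_approx D S Y : closed_sat D -> rel_comp E' S = S ->
  Gdefinable c Y -> S `<=` Y ->
  exists T, [/\ closed_sat T, T `<=` D, T `&` S = set0 & D `<=` Y `|` T].
Proof.
move=> [/Gtype_definableP[A sA tD] ED] ES dY SY.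
have [nat_small _ _ _ _] := hN.
exists (rel_comp E' (~` Y) `&` D); split=> //.
- have [B fB dYB] := Gdefinable_finite dY.
  have sB := finite_small nat_small fB.
  split; last by apply: saturatedI => //; exact: rel_comp_idem.
  apply/Gtype_definableP; exists ((B `|` M `|` params c g) `|` A).
    apply: small_setU sA => //; apply: small_setU => //.
      by apply: small_setU.
    exact/finite_small/params_finite.
  apply: tdefinableI.
    apply: tdefinable_sub (tdefinable_rel_comp hN hM sM hG hphi (g := g) sB _).
      by move=> x; left.
    by apply: tdefinable_def; exact: GdefinableC.
  by apply: tdefinable_sub tD => x; right.
- rewrite -subset0 => x [[Yx _] Sx].
  by apply: (rel_comp_subC eqE' ES _ Sx Yx) => z /SY Yz; apply.
- move=> x Dx; have [Yx|nYx] := pselect (Y x); [by left|right].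
  by split=> //; exact: sub_rel_comp.
Qed.

Lemma outer_mean_adherent D (e : R) : 0 < e ->
  exists Z, [/\ Gdefinable c Z, D `<=` Z & m Z < outer_mean D + e].
Proof.
move=> e0; have [_ [Z [dZ DZ] <-] mZ] := inf_adherent e0 (conj (cover_n0 D) (cover_lb D)).
by exists Z.
Qed.

Lemma outer_mean_modular D D' : closed_sat D -> closed_sat D' ->
  outer_mean (D `|` D') = outer_mean D + outer_mean D' - outer_mean (D `&` D').
Proof.
move=> cD cD'; have [_ ED] := cD; have [_ ED'] := cD'.
have EDD' := saturatedI eqE' ED ED'.
have cDD' : closed_sat (D `&` D').
  split=> //; move: cD cD' => [/Gtype_definableP[A sA tD] _] [/Gtype_definableP[A' sA' tD'] _].
  apply/Gtype_definableP; exists (A `|` A').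
    by have [nat_small _ _ _ _] := hN; exact: small_setU.
  by apply: tdefinableI; [apply: tdefinable_sub tD|apply: tdefinable_sub tD'] => x;
    [left|right].
apply/eqP; rewrite eq_le; apply/andP; split.
- rewrite lerBrDr; apply/ler_addgt0Pr => e e0.
  (* [Y] has almost the value of [D'] and [T] covers the rest of [D]: together they cover the union,
     while [T] and the intersection are disjoint parts of [D]. *)
  have [Y [dY D'Y mY]] := outer_mean_adherent D' e0.
  have [T [cT TD TD' DYT]] := outer_mean_approx cD ED' dY D'Y.
  have : outer_mean (D `|` D') <= m Y + outer_mean T.
    by apply: outer_mean_cover => // x [/DYT//|/D'Y]; left.
  have : outer_mean T + outer_mean (D `&` D') <= outer_mean D.
    apply: le_trans (outer_mean_disjoint cT cDD' _) _.
      by rewrite (setIC D) setIA TD' set0I.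
    by apply: outer_mean_mono => x [/TD|[]].
  move: mY; lra.
- rewrite lerBlDr; apply/ler_addgt0Pr => e e0.
  (* Now [Y] approximates the intersection. As a subset of [D] that misses the intersection, [T]
     misses [D']. *)
  have [Y [dY D'Y mY]] := outer_mean_adherent (D `&` D') e0.
  have [T [cT TD TD' DYT]] := outer_mean_approx cD EDD' dY D'Y.
  have : outer_mean D <= m Y + outer_mean T by exact: outer_mean_cover.
  have : outer_mean T + outer_mean D' <= outer_mean (D `|` D').
    apply: le_trans (outer_mean_disjoint cT cD' _) _.
      by rewrite -(setIidl TD) -setIA TD'.
    by apply: outer_mean_mono => x [/TD|]; [left|right].
  move: mY; lra.
Qed.

End Saturated.

Lemma normalized_outer_mean : normalized_mean (D_lattice c phi K M) outer_mean.
Proof.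
have [m01 mmono [m0 m1] msub madd] := hm.
have o0 : outer_mean set0 = 0.
  apply/eqP; rewrite eq_le -{1}m0 outer_mean_le//=; last exact: Gdefinable0.
  by apply: le_outer_mean => Z dZ _; have /andP[] := m01 _ dZ.
have o1 : outer_mean setT = 1.
  apply/eqP; rewrite eq_le -{1}m1 outer_mean_le//=.
  by apply: le_outer_mean => Z dZ TZ; rewrite -m1; exact: mmono.
split=> //.
- by move=> Y _; rewrite -{1}o0 -o1 !outer_mean_mono.
- by move=> Y Y' _ _; exact: outer_mean_mono.
move=> D D' [tD [r [g ED]]] [tD' [r' [g' ED']]].
(* [D] and [D'] are saturated for different intersections of translates; the concatenated list gives
   a finer relation for which both are. *)
pose h (j : 'I_(r + r'.+1).+1) :=
  match fintype.split (j : 'I_(r.+1 + r'.+1)) with inl x => g x | inr x => g' x end.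
pose E' := \bigcap_j ltrans_rel (h j) (family_rel c phi M).
have eqI q (f : 'I_q.+1 -> G) :
    equivalence_on_G (\bigcap_j ltrans_rel (f j) (family_rel c phi M)).
  by apply: equivalence_bigcap => j; exact: equivalence_ltrans.
apply: (@outer_mean_modular _ h); split=> //.
  apply: saturated_sub ED => // p pE j _.
  by have := pE (lshift r'.+1 j) Logic.I; rewrite /h -[lshift _ _]/(unsplit (inl j)) unsplitK.
apply: saturated_sub ED' => // p pE j _.
by have := pE (rshift r.+1 j) Logic.I; rewrite /h -[rshift _ _]/(unsplit (inr j)) unsplitK.
Qed.

Lemma outer_mean_ltrans (H : set G) : left_invariant H (Gdefinable c) m ->
  left_invariant H (D_lattice c phi K M) outer_mean.
Proof.
move=> mH h D Hh _.
have dh g Z : Gdefinable c Z -> Gdefinable c (ltrans g Z) by exact: Gdefinable_ltrans.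
apply/eqP; rewrite eq_le; apply/andP; split; apply: le_outer_mean => Z dZ DZ.
  rewrite -(mH h Z)//; apply: outer_mean_le; first exact: dh.
  by move=> _ [x /DZ Zx <-]; exists x.
(* Only [h], and not its inverse, is known to lie in [H]; so the invariance under [h] is applied to
   the translate of [Z] by the inverse. *)
have -> : Z = ltrans h (ltrans h^-1 Z).
  by apply/seteqP; split=> x; rewrite !mem_ltrans invgK mulKVg.
rewrite mH//; last exact: dh.
apply: outer_mean_le => [|x Dx]; first exact: dh.
by rewrite mem_ltrans invgK; apply: DZ; exists x.
Qed.

End PreMeanToMean.

(** * Measures from contents on compact normal spaces *)

Section ContentToMeasure.
Context (R : realType) (T : ptopologicalType) (rho : set T -> R).
Hypothesis cptT : compact [set: T].
Hypothesis normalT : forall A B : set T, closed A -> closed B -> A `&` B = set0 ->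
  exists U V, [/\ open U, open V, A `<=` U, B `<=` V & U `&` V = set0].
Hypothesis rho0 : rho set0 = 0%R.
Hypothesis rhoT : rho setT = 1%R.
Hypothesis rho_mono : forall C D, closed C -> closed D -> C `<=` D -> (rho C <= rho D)%R.
Hypothesis rho_sub : forall C D, closed C -> closed D ->
  (rho (C `|` D) <= rho C + rho D)%R.
Hypothesis rho_add : forall C D, closed C -> closed D -> C `&` D = set0 ->
  (rho C + rho D <= rho (C `|` D))%R.
Local Open Scope ereal_scope.

Definition inner_content (U : set T) : \bar R :=
  ereal_sup [set (rho C)%:E | C in [set C | closed C /\ C `<=` U]].

Definition outer_content (A : set T) : \bar R :=
  ereal_inf [set inner_content U | U in [set U | open U /\ A `<=` U]].

Lemma inner_content_ge C U : closed C -> C `<=` U -> (rho C)%:E <= inner_content U.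
Proof. by move=> cC CU; apply: ereal_sup_ubound; exists C. Qed.

Lemma inner_content_le U x : (forall C, closed C -> C `<=` U -> (rho C)%:E <= x) ->
  inner_content U <= x.
Proof. by move=> H; apply: ge_ereal_sup => _ [C [cC CU] <-]; exact: H. Qed.

Lemma outer_content_le A U : open U -> A `<=` U -> outer_content A <= inner_content U.
Proof. by move=> oU AU; apply: ereal_inf_lbound; exists U. Qed.

Lemma outer_content_ge A x : (forall U, open U -> A `<=` U -> x <= inner_content U) ->
  x <= outer_content A.
Proof. by move=> H; apply: le_ereal_inf_tmp => _ [U [oU AU] <-]; exact: H. Qed.

Lemma inner_content_ge0 U : 0 <= inner_content U.
Proof.
have -> : 0 = (rho set0)%:E by rewrite rho0.
by apply: inner_content_ge => //; exact: closed0.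
Qed.

Lemma inner_content_mono U V : U `<=` V -> inner_content U <= inner_content V.
Proof.
by move=> UV; apply: inner_content_le => C cC CU; apply: inner_content_ge => // x /CU/UV.
Qed.

Lemma inner_content_le1 U : inner_content U <= 1.
Proof.
apply: inner_content_le => C cC _; rewrite lee_fin -rhoT.
by apply: rho_mono => //; exact: closedT.
Qed.

Lemma inner_contentT : inner_content setT = 1.
Proof.
apply/eqP; rewrite eq_le inner_content_le1/=.
have -> : 1 = (rho setT)%:E by rewrite rhoT.
by apply: inner_content_ge => //; exact: closedT.
Qed.

Lemma inner_contentU U V : open U -> open V ->
  inner_content (U `|` V) <= inner_content U + inner_content V.
Proof.
move=> oU oV; apply: inner_content_le => C cC CUV.
(* Normality splits [C] into two closed pieces: the part outside [W1] lies in [U], the part outside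
   [W2] lies in [V]. *)
have [| | |W1 [W2 [oW1 oW2 CW1 CW2 W12]]] := @normalT (C `&` ~` U) (C `&` ~` V).
- by apply: closedI => //; exact: open_closedC.
- by apply: closedI => //; exact: open_closedC.
- by rewrite -subset0 => x [[Cx nUx] [_ nVx]]; case: (CUV _ Cx).
have cC1 : closed (C `&` ~` W1) by apply: closedI => //; exact: open_closedC.
have cC2 : closed (C `&` ~` W2) by apply: closedI => //; exact: open_closedC.
apply: (@le_trans _ _ (rho (C `&` ~` W1) + rho (C `&` ~` W2))%:E).
  rewrite lee_fin; apply: le_trans (rho_sub cC1 cC2).
  apply: rho_mono => //; first exact: closedU.
  move=> x Cx; have [W1x|nW1x] := pselect (W1 x); [right|by left].
  by split=> // W2x; rewrite -[False]/(set0 x) -W12.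
rewrite EFinD; apply: leeD; apply: inner_content_ge => // x [Cx nWx].
  by apply: contrapT => nUx; apply/nWx/CW1.
by apply: contrapT => nVx; apply/nWx/CW2.
Qed.

(** A closed subset of the union is compact, so finitely many [U i] cover it and finite
    subadditivity suffices. *)
Lemma inner_content_bigcup (U : (set T)^nat) : (forall i, open (U i)) ->
  inner_content (\bigcup_i U i) <= \sum_(i <oo) inner_content (U i).
Proof.
move=> oU; apply: inner_content_le => C cC CU.
have cptC : compact C by apply: subclosed_compact cptT _.
move: cptC; rewrite compact_cover => /(_ nat setT U (fun i _ => oU i) CU)[D _ CD].
pose n := (\max_(i <- finmap.enum_fset D) i).+1.
have finU k : open (\bigcup_(i in `I_k) U i) /\
    inner_content (\bigcup_(i in `I_k) U i) <= \sum_(0 <= i < k) inner_content (U i).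
  elim: k => [|k [ok IH]].
    rewrite II0 bigcup_set0 big_nil; split; first exact: open0.
    by apply: inner_content_le => E _; rewrite subset0 => ->; rewrite rho0.
  rewrite IIS bigcup_setU bigcup_set1; split; first exact: openU.
  rewrite big_nat_recr//=; apply: le_trans (inner_contentU ok (oU k)) _.
  exact: leeD2r.
apply: le_trans (@nneseries_lim_ge _ (fun i => inner_content (U i)) xpredT 0 n _); last first.
  by move=> *; exact: inner_content_ge0.
apply: le_trans (finU n).2; apply: inner_content_ge => // x /CD[i iD Uix].
by exists i => //=; rewrite /n ltnS; exact: (@leq_bigmax_seq _ _ xpredT id).
Qed.

Lemma outer_contentE U : open U -> outer_content U = inner_content U.
Proof.
move=> oU; apply/eqP; rewrite eq_le outer_content_le//=.
by apply: outer_content_ge => V _; exact: inner_content_mono.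
Qed.

Lemma outer_content0 : outer_content set0 = 0.
Proof.
rewrite outer_contentE; last exact: open0.
apply/eqP; rewrite eq_le inner_content_ge0 andbT.
by apply: inner_content_le => C _; rewrite subset0 => ->; rewrite rho0.
Qed.

Lemma outer_content_ge0 A : 0 <= outer_content A.
Proof. by apply: outer_content_ge => U _ _; exact: inner_content_ge0. Qed.

Lemma outer_content_mono : {homo outer_content : A B / A `<=` B >-> A <= B}.
Proof.
move=> A B AB; apply: outer_content_ge => U oU BU.
by apply: outer_content_le => // x /AB/BU.
Qed.

Lemma outer_content_le1 A : outer_content A <= 1.
Proof. by rewrite -inner_contentT; apply: outer_content_le => //; exact: openT. Qed.

Lemma outer_content_fin A : outer_content A \is a fin_num.
Proof.
by rewrite ge0_fin_numE ?outer_content_ge0// (le_lt_trans (outer_content_le1 A))// ltry.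
Qed.

Lemma outer_content_sigma_subadditive : sigma_subadditive outer_content.
Proof.
move=> A; apply/lee_addgt0Pr => e e0.
apply: le_trans (epsilon_trick xpredT (fun i => outer_content_ge0 (A i)) (ltW e0)).
have /(_ _)/cid-/all_sig[U UA] i : exists U, [/\ open U, A i `<=` U &
    inner_content U <= outer_content (A i) + (e / (2 ^ i.+1)%:R)%:E].
  have [|_ [U [oU AU] <-] /ltW Ue] := @lb_ereal_inf_adherent _
      [set inner_content U | U in [set U | open U /\ A i `<=` U]]
      (e / (2 ^ i.+1)%:R)%R _ (outer_content_fin (A i)).
    by rewrite divr_gt0// ltr0n expn_gt0.
  by exists U.
have oU i : open (U i) by have [] := UA i.
apply: le_trans (_ : inner_content (\bigcup_i U i) <= _).
  apply: outer_content_le; first exact: bigcup_open.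
  by move=> x [i _ Ax]; exists i => //; have [_ + _] := UA i; exact.
apply: le_trans (inner_content_bigcup oU) _; apply: lee_nneseries => i _.
  by move=> _; exact: inner_content_ge0.
by have [] := UA i.
Qed.

HB.instance Definition _ := isOuterMeasure.Build R T outer_content
  outer_content0 outer_content_ge0 outer_content_mono
  outer_content_sigma_subadditive.

(** Superadditivity of [rho] is the reason. For [V] open around [A], a closed [C] inside both [V]
    and [U] and a closed [D] inside [V] minus [C] are disjoint closed subsets of [V]; taking suprema
    over [D], then over [C], bounds the two parts of [A] by the inner content of [V]. *)
Lemma open_caratheodory U : open U -> outer_content.-caratheodory U.
Proof.
move=> oU; apply: le_caratheodory_measurable => A; apply: outer_content_ge => V oV AV.
have oVU : open (V `&` U) by exact: openI.
apply: (@le_trans _ _ (inner_content (V `&` U) + outer_content (A `&` ~` U))).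
  by apply: leeD2r; apply: outer_content_le => // x [/AV].
rewrite -leeBrDr ?outer_content_fin//; apply: inner_content_le => C cC CVU.
rewrite leeBrDr ?outer_content_fin// addeC -leeBrDr//.
apply: (@le_trans _ _ (inner_content (V `&` ~` C))).
  apply: outer_content_le; first by apply: openI => //; exact: closed_openC.
  by move=> x [/AV Vx nUx]; split=> // /CVU[].
apply: inner_content_le => D cD DVC; rewrite leeBrDr// -EFinD.
apply: le_trans (_ : (rho (D `|` C))%:E <= _).
  by rewrite lee_fin; apply: rho_add => //; rewrite -subset0 => x [/DVC[]].
by apply: inner_content_ge; [exact: closedU|move=> x [/DVC[]|/CVU[]]].
Qed.

(** The same function on the type that carries the Borel sigma-algebra; its own name holds the
    measure structure. *)
Definition borel_content : set (g_sigma_algebraType (@open T)) -> \bar R :=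
  outer_content.

Lemma borel_caratheodory (B : set (g_sigma_algebraType (@open T))) :
  measurable B -> outer_content.-caratheodory B.
Proof.
apply: smallest_sub => [|U oU]; last exact: open_caratheodory.
split.
- exact: caratheodory_measurable_set0.
- by move=> A; rewrite setTD; exact: caratheodory_measurable_setC.
- exact: caratheodory_measurable_bigcup.
Qed.

Lemma borel_content_sigma_additive : semi_sigma_additive borel_content.
Proof.
move=> F mF tF mUF; apply: caratheodory_measure_sigma_additive => //.
  by move=> i; exact: borel_caratheodory.
exact: borel_caratheodory.
Qed.

HB.instance Definition _ := isMeasure.Build _ _ _ borel_content
  outer_content0 outer_content_ge0 borel_content_sigma_additive.

Lemma borel_contentT : borel_content setT = 1.
Proof. by rewrite /borel_content outer_contentE ?inner_contentT//; exact: openT. Qed.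

HB.instance Definition _ :=
  Measure_isProbability.Build _ _ _ borel_content borel_contentT.

Lemma content_probability : exists mu : probability (g_sigma_algebraType (@open T)) R,
  forall B, mu B = outer_content B.
Proof. by exists borel_content. Qed.

(** Applying this inequality to the inverse map as well gives equality, which is how invariance of
    the measure is obtained. *)
Lemma outer_content_image (f g : T -> T) A : cancel f g -> cancel g f ->
  (forall C, closed C -> closed (f @` C)) -> (forall C, closed C -> closed (g @` C)) ->
  (forall C, closed C -> rho (g @` C) = rho C) ->
  outer_content (f @` A) <= outer_content A.
Proof.
move=> fK gK cf cg rhog; apply: outer_content_ge => U oU AU.
have mem_f B x : (f @` B) x <-> B (g x).
  by split=> [[y By <-]|Bx]; [rewrite fK|exists (g x)].
apply: (@le_trans _ _ (inner_content (f @` U))).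
  apply: outer_content_le; last by move=> x /mem_f/AU Ux; apply/mem_f.
  suff -> : f @` U = ~` (f @` (~` U)) by apply/closed_openC/cf/open_closedC.
  apply/seteqP; split=> x => [/mem_f Ux /mem_f//|nUx]; apply/mem_f.
  by apply: contrapT => Ux; apply: nUx; apply/mem_f.
apply: inner_content_le => C cC CU; rewrite -rhog//.
by apply: inner_content_ge; [exact: cg|move=> _ [x /CU/mem_f Ux <-]].
Qed.

End ContentToMeasure.

(** * The topology of the space of types *)

Section Automorphisms.
Context (L : language) (N : structure L).

Lemma automorphism_sat (s : N -> N) : automorphism s ->
  forall V (phi : formula L V) (v : V -> N), sat phi v <-> sat phi (s \o v).
Proof.
move=> [[t sK tK] sf sr] V phi.
have evalE W (v : W -> N) (u : term L W) : Defs.eval (s \o v) u = s (Defs.eval v u).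
  elim: u => //= f ts IH; rewrite sf; congr finterp; exact/funext.
elim: phi => /= [U u u'|U r ts|U|U p IHp q IHq|U p IHp] v.
- by rewrite !evalE; split=> [->//|/(can_inj sK)].
- by under [X in _ <-> rinterp X]eq_fun do rewrite evalE; exact: sr.
- by [].
- by split=> pq ?; apply/(IHq v)/pq/(IHp v).
- have oE a : oapp (s \o v) (s a) = s \o oapp v a by apply/funext => -[].
  split=> H a; first by rewrite -(tK a) oE; apply/(IHp (oapp v (t a))).
  by apply/(IHp (oapp v a)); rewrite -oE.
Qed.

Lemma automorphism_inv (s t : N -> N) : cancel s t -> cancel t s ->
  automorphism s -> automorphism t.
Proof.
move=> sK tK [_ sf sr].
have stv V (v : V -> N) : s \o (t \o v) = v by apply/funext => x /=.
split=> [|f v|r v]; first by exists s.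
  by apply: (can_inj sK); rewrite tK sf stv.
by rewrite -{1}(stv _ v); apply: iff_sym; exact: sr.
Qed.

Section Over.
Context (A : set N) (s : N -> N) (hs : automorphism_over A s).

Lemma automorphism_definable V (Y : set (V -> N)) v : definable A Y ->
  Y v <-> Y (s \o v).
Proof.
have [aut fixA] := hs; move=> /definableP[phi YE]; rewrite !YE /sat_over.
rewrite (automorphism_sat aut) (_ : s \o _ = vjoin (s \o v) val)//.
by apply/funext => -[//|a] /=; apply: fixA; apply: set_mem; exact: valP.
Qed.

Lemma automorphism_over_inv :
  exists t, [/\ cancel s t, cancel t s & automorphism_over A t].
Proof.
have [aut fixA] := hs; have [[t sK tK] _ _] := aut; exists t; split=> //.
by split; [exact: automorphism_inv aut|move=> a Aa; rewrite -{1}(fixA a Aa) sK].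
Qed.

Lemma automorphism_over_comp t : automorphism_over A t -> automorphism_over A (t \o s).
Proof.
move=> [[tb tf tr] tA]; have [[sb sf sr] sA] := hs; split.
  split; first exact: bij_comp.
    by move=> f v /=; rewrite sf tf.
  by move=> r v; rewrite sr tr.
by move=> a Aa /=; rewrite sA// tA.
Qed.

End Over.

Lemma automorphism_over_id A : automorphism_over A (@id N).
Proof. by split=> //; split=> //; exists id. Qed.

End Automorphisms.

(** * The space of types of the quotient: closed sets, compactness, normality, group action *)

Section QuotientTopology.
Context (L : language) (N : structure L) (K : Type) (hN : monster N K).
Context (M : set N) (hM : elementary_submodel M) (sM : small K M).
Context (n : nat) (G : groupType) (c : G -> 'I_n -> N) (hG : definable_group c).
Context (d : Order.disp_t) (I : porderType d) (k : I -> nat).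
Context (phi : forall i, formula L ('I_n + 'I_n + 'I_(k i))).
Hypothesis hphi : or_definable_family c phi.
Let E := family_rel c phi M.
Hypothesis eqE : equivalence_on_G E.
Hypothesis invE : rel_invariant (Gpoints c M) E.

Let c_inj : injective c. Proof. by case: hG. Qed.

Let Er x : E (x, x). Proof. by have [] := eqE. Qed.
Let Es x y : E (x, y) -> E (y, x). Proof. by have [_ + _] := eqE; apply. Qed.
Let Et x y z : E (x, y) -> E (y, z) -> E (x, z).
Proof. by have [_ _] := eqE; apply. Qed.

Lemma tuple_in_G A s a : automorphism_over A s -> exists b, c b = s \o c a.
Proof.
move=> hs.
have [+ _] := automorphism_definable hs (c a) (definable_in_G hG A (@id 'I_n)).
by case=> [|b _ bE]; [exists a|exists b].
Qed.

Lemma automorphism_Gdefinable s Z a b : automorphism_over M s ->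
  Gdefinable_over c M Z -> c b = s \o c a -> Z a <-> Z b.
Proof.
move=> hs dZ bE; apply: iff_trans (iff_sym (c_imageE hG Z a)) _.
apply: iff_trans (c_imageE hG Z b); rewrite bE.
by have := automorphism_definable hs (c a) (dZ : definable M (c @` Z)).
Qed.

Lemma automorphism_family_rel s a b a' b' : automorphism_over M s ->
  c a' = s \o c a -> c b' = s \o c b -> E (a, b) <-> E (a', b').
Proof.
move=> [aut fixM] aE bE.
have abE i (e : 'I_(k i) -> N) : (forall t, M (e t)) ->
    instance_rel c phi e (a, b) <-> instance_rel c phi e (a', b').
  move=> Me; rewrite /instance_rel /= (automorphism_sat aut) aE bE.
  rewrite (_ : s \o _ = vjoin (vjoin (s \o c a) (s \o c b)) e)//.
  by apply/funext => -[[]|t] //=; exact: fixM.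
by split=> H i e Me; apply/(abE _ _ Me); exact: H.
Qed.

Lemma automorphism_mul s a b a' b' ab' : automorphism_over M s ->
  c a' = s \o c a -> c b' = s \o c b -> c ab' = s \o c (a * b)%g -> (ab' = a' * b')%g.
Proof.
move=> hs aE bE abE; apply: c_inj; apply/(gmulE hG); rewrite aE bE abE.
pose f0 (t : 'I_n) : 'I_n + 'I_n + 'I_n := inl (inl t).
pose f1 (t : 'I_n) : 'I_n + 'I_n + 'I_n := inl (inr t).
pose f2 (t : 'I_n) : 'I_n + 'I_n + 'I_n := inr t.
have := automorphism_definable hs (vjoin (vjoin (c a) (c b)) (c (a * b)%g))
  (definable_gmul hG M f0 f1 f2).
by move=> [+ _]; apply; apply/(gmulE hG).
Qed.

Lemma aut_image_eclass s a b : automorphism_over M s -> c b = s \o c a ->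
  aut_image c s (eclass E a) = eclass E b.
Proof.
move=> hs bE; apply/seteqP; split=> [y [x ax yE]|y by_].
  exact/(automorphism_family_rel hs bE yE).
have [t [sK tK ht]] := automorphism_over_inv hs.
have [x xE] := tuple_in_G y ht.
have yE : c y = s \o c x by rewrite xE; apply/funext => i /=; rewrite tK.
by exists x => //; apply/(automorphism_family_rel hs bE yE).
Qed.

Lemma orbit_ofP a b : orbit_of c M E a = orbit_of c M E b <->
  exists s b', [/\ automorphism_over M s, c b' = s \o c b & E (a, b')].
Proof.
have sub s x y y' : automorphism_over M s -> c y' = s \o c y -> E (x, y') ->
    orbit_set c M E x `<=` orbit_set c M E y.
  move=> hs y'E xy' _ [t ht <-]; have ts := automorphism_over_comp hs ht.
  exists (t \o s) => //; have [z zE] := tuple_in_G x ht.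
  have [z' z'E] := tuple_in_G y ts.
  rewrite (aut_image_eclass ht zE) (aut_image_eclass ts z'E).
  have z'E' : c z' = t \o c y' by rewrite z'E y'E.
  have zz' : E (z, z') by apply/(automorphism_family_rel ht zE z'E').
  by apply/seteqP; split=> u; [exact: Et|exact/Et/Es].
split=> [/(congr1 val)/= ab|[s [b' [hs b'E ab']]]].
  have : orbit_set c M E b (eclass E a).
    rewrite -ab; exists id; first exact: automorphism_over_id.
    by rewrite (aut_image_eclass (automorphism_over_id M) (b := a)).
  move=> [s hs]; have [b' b'E] := tuple_in_G b hs.
  rewrite (aut_image_eclass hs b'E) => bb'; exists s, b'; split=> //.
  by rewrite -[E _]/(eclass E a b') -bb'; exact: Er.
apply: val_inj; apply/seteqP; split; first exact: sub hs b'E ab'.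
have [t [sK tK ht]] := automorphism_over_inv hs.
have [a' a'E] := tuple_in_G a ht.
apply: (sub t b a a') => //; have bE : c b = t \o c b'.
  by rewrite b'E; apply/funext => i /=; rewrite sK.
exact/Es/(automorphism_family_rel ht a'E bE).
Qed.

Lemma orbit_of_surj (o : quotient_types c M E) : exists a, orbit_of c M E a = o.
Proof. by case: o => o oP; have [a _ aE] := set_mem oP; exists a; exact: val_inj. Qed.

Lemma orbit_of_rel a b : E (a, b) -> orbit_of c M E a = orbit_of c M E b.
Proof.
by move=> ab; apply/orbit_ofP; exists id, b; split=> //; exact: automorphism_over_id.
Qed.

Lemma Gdefinable_overE Z : Gdefinable_over c M Z ->
  exists psi : formula L ('I_n + M), forall a, Z a <-> sat_over psi (c a).
Proof.
by move=> /definableP[psi psiE]; exists psi => a; rewrite -psiE (c_imageE hG).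
Qed.

Lemma Gdefinable_over_sat (psi : formula L ('I_n + M)) :
  Gdefinable_over c M [set a | sat_over psi (c a)].
Proof.
by apply: (Gdefinable_overP hG (P := [set v | sat_over psi v])) => //; exists psi.
Qed.

(** The inclusion is symmetric, by complements. Each element of [M] or coordinate of [a] has a name
    in ['I_n + M]; reading names with [b] in place of [a] is an elementary map, which strong
    homogeneity extends to an automorphism. *)
Lemma homogeneous a b :
  (forall Z, Gdefinable_over c M Z -> Z a -> Z b) ->
  exists2 s, automorphism_over M s & c b = s \o c a.
Proof.
move=> ab; have [nat_small _ _ _ homN] := hN.
have satE (psi : formula L ('I_n + M)) : sat_over psi (c a) <-> sat_over psi (c b).
  have imp (chi : formula L ('I_n + M)) : sat_over chi (c a) -> sat_over chi (c b).
    by apply: (ab [set x | sat_over chi (c x)]); exact: Gdefinable_over_sat.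
  split; first exact: imp.
  by move=> bpsi; apply: contrapT => /(imp (neg psi)); exact.
pose A := range (c a) `|` M.
have sA : small K A.
  apply: small_setU => //; apply: finite_small => //.
  exact/finite_image/finite_finset.
have /(_ _)/cid-/all_sig[h hE] : forall x, exists z : 'I_n + M, A x -> vjoin (c a) val z = x.
  move=> x; have [[[i _ <-]|Mx]|nAx] := pselect (A x).
  - by exists (inl i).
  - by exists (inr (exist _ x (mem_set Mx))).
  - have [M0 [j [_ ME]]] := hM; have [x0] := carrier_inh M0.
    have Mx0 : M (j x0) by rewrite ME; exists x0.
    by exists (inr (exist _ (j x0) (mem_set Mx0))).
pose f x := vjoin (c b) val (h x).
have fE (z : 'I_n + M) : f (vjoin (c a) val z) = vjoin (c b) val z.
  have Az : A (vjoin (c a) val z).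
    by case: z => [i|x]; [left; exists i|right; exact: (set_mem (valP x))].
  (* The chosen name may differ from the given one; that both denote the same element is a formula
     true of [a], hence of [b]. *)
  by apply: (satE (Eq (Var L (h (vjoin (c a) val z))) (Var L z))).1; exact: hE.
have felem : elementary_map A f.
  move=> q psi v Av; have vE : v = vjoin (c a) val \o (h \o v).
    by apply/funext => i /=; rewrite hE.
  rewrite {1}vE -sat_rename.
  have -> : f \o v = vjoin (c b) val \o (h \o v) by [].
  by rewrite -sat_rename; exact: satE.
have [s aut sE] := homN A f sA felem.
exists s; last first.
  by apply/funext => i /=; rewrite sE; [exact: esym (fE (inl i))|left; exists i].
split=> // x Mx; rewrite sE; last by right.
exact: (fE (inr (exist _ x (mem_set Mx)))).
Qed.

Lemma Gtypes_tp a : Gtypes c [set psi : formula L ('I_n + M) | sat_over psi (c a)].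
Proof.
split; first split=> [q qp _|psi]; first by exists (c a).
  by have [|] := pselect (sat_over psi (c a)); [left|right].
have /definableP[psi psiE] := definable_in_G hG M (@id 'I_n).
exists psi => [|v vpsi]; first by apply/psiE; exists a.
by have [b _ bE] := (psiE v).2 vpsi; exists b.
Qed.

Definition tp a : Gtype_space c M :=
  exist _ [set psi : formula L ('I_n + M) | sat_over psi (c a)]
    (mem_set (Gtypes_tp a)).

(** Saturation gives a realizing tuple, and the formula required by [Gtypes] puts it in the group;
    so [xget] never returns its default. *)
Lemma type_realized (p : Gtype_space c M) :
  realizes (c (xget 1%g [set a | realizes (c a) (val p)])) (val p).
Proof.
have [[pcons pcompl] [psi ppsi psiG]] := set_mem (valP p).
have [_ _ _ satN _] := hN.
have [v vp] := satN M sM n (val p) (conj pcons pcompl).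
have [a _ aE] := psiG v (vp _ ppsi).
by case: xgetP => [x -> //|/(_ a)]; case; rewrite /= aE.
Qed.

Lemma type_proj_tp a : type_proj E (tp a) = orbit_of c M E a.
Proof.
rewrite /type_proj; set b := xget _ _.
have bp : realizes (c b) (val (tp a)) := @type_realized (tp a).
have [Z dZ Za|s hs bE] := @homogeneous a b.
  have [psi psiE] := Gdefinable_overE dZ; apply/psiE; apply: (bp psi).
  exact/psiE.
by apply/esym/orbit_ofP; have [t [sK tK ht]] := automorphism_over_inv hs;
  exists t, a; split=> //; rewrite bE; apply/funext => i /=; rewrite sK.
Qed.

(** These turn out to be the preimages in [G] of the closed sets of the quotient space. *)
Definition Gclosed (D : set G) : Prop := tdefinable c M D /\ rel_comp E D = D.

(** Type-definable sets over [M] are preserved by automorphisms over [M], so saturation under [E]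
    already implies saturation under orbits. *)
Lemma Gclosed_orbit D a b : Gclosed D ->
  orbit_of c M E a = orbit_of c M E b -> D a -> D b.
Proof.
move=> [tD /(saturatedP eqE) satD] /orbit_ofP[s [b' [hs b'E ab']]] Da.
apply: tD => Z dZ DZ; apply/(automorphism_Gdefinable hs dZ b'E)/DZ.
exact: satD ab'.
Qed.

Lemma Gclosed_image D : Gclosed D -> orbit_of c M E @^-1` (orbit_of c M E @` D) = D.
Proof.
move=> cD; apply/seteqP; split=> [a [b Db /esym ab]|a Da]; last by exists a.
by apply: Gclosed_orbit cD _ Db; exact: esym.
Qed.

Lemma open_tp (U : set (Gtype_space c M)) a : open U -> U (tp a) ->
  exists Z, [/\ Gdefinable_over c M Z, Z a & forall b, Z b -> U (tp b)].
Proof.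
move=> [B BfinI <-] [A BA Aa]; have [S Ssub SA] := BfinI _ BA.
pose s := finmap.enum_fset S.
exists [set b | forall i, i \in s -> (i : set (Gtype_space c M)) (tp b)]; split.
- pose P (i : set (Gtype_space c M)) := c @` [set b | i (tp b)].
  apply: (Gdefinable_overP hG (P := [set v | forall i, i \in s -> P i v])) => [b|].
    have PE i : P i (c b) <-> i (tp b) := c_imageE hG _ b.
    by split=> Sb i si; apply/PE; exact: Sb.
  apply: definable_forall_seq => i si.
  have /set_mem[psi _ psiE] := Ssub _ si.
  by rewrite /P -psiE; exact: Gdefinable_over_sat.
- by move=> i si; move: Aa; rewrite -SA; exact.
- move=> b Zb; exists A => //.
  suff : A (tp b) by [].
  by rewrite -SA => i iS; exact: (Zb i iS).
Qed.

Lemma closed_Gclosed (F : set (quotient_types c M E)) :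
  closed F -> Gclosed (orbit_of c M E @^-1` F).
Proof.
move=> cF; have oF : open (type_proj E @^-1` (~` F)) := closed_openC cF.
split.
  move=> a Ha; apply: contrapT => nFa.
  have [|Z [dZ Za ZF]] := open_tp (a := a) oF.
    by rewrite /preimage /= type_proj_tp.
  apply: (Ha (~` Z)) => //; first exact: GdefinableC.
  by move=> b Fb /ZF; rewrite /preimage /= type_proj_tp; exact.
by apply/(saturatedP eqE) => a b Fa /orbit_of_rel ab; rewrite /preimage /= -ab.
Qed.

Lemma tdefinable_closed (F : set (quotient_types c M E)) :
  tdefinable c M (orbit_of c M E @^-1` F) -> closed F.
Proof.
move=> tF; rewrite -[F]setCK; apply: open_closedC.
suff : open (type_proj E @^-1` (~` F)) by [].
rewrite openE => p pF.
pose a := xget 1%g [set a | realizes (c a) (val p)].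
have ap : realizes (c a) (val p) := @type_realized p.
have nFa : ~ (orbit_of c M E @^-1` F) a := pF.
have [Z [dZ FZ nZa]] : exists Z, [/\ Gdefinable_over c M Z,
    orbit_of c M E @^-1` F `<=` Z & ~ Z a].
  apply: contrapT => H; apply: nFa; apply: tF => Z dZ FZ; apply: contrapT => nZa.
  by apply: H; exists Z.
have [psi psiE] := Gdefinable_overE dZ.
have oneg : open (basic_clopen (c := c) (neg psi)).
  exists [set basic_clopen (neg psi)]; last by rewrite bigcup_set1.
  by move=> _ ->; apply: finI_from1; exists (neg psi).
apply: filterS (open_nbhs_nbhs (conj oneg _)).
  move=> q qneg; rewrite /type_proj /= => /FZ /psiE.
  exact: (@type_realized q (neg psi) qneg).
have [[_ pcompl] _] := set_mem (valP p).
by have [/ap/psiE|] := pcompl psi.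
Qed.

Lemma closed_image D : Gclosed D -> closed (orbit_of c M E @` D).
Proof. by move=> cD; apply: tdefinable_closed; rewrite Gclosed_image//; case: cD. Qed.

(** The identity is the only idempotent, and idempotency is a formula, so Tarski-Vaught finds it in
    [M]. *)
Lemma Gpoints1 : Gpoints c M 1%g.
Proof.
have [|w ww Mw] := tarski_vaught hM (definable_gmul hG M (@id 'I_n) id id).
  by exists (c 1%g); apply/(gmulE hG); rewrite mulg1.
have [a [b [aw bw abw]]] := ww; have ab : a = b by apply: c_inj; rewrite -aw -bw.
suff a1 : a = 1%g by move=> i; move: (Mw i) (congr1 (@^~ i) aw) => /= + wa; rewrite wa a1.
by apply: (@mulgI _ a); rewrite mulg1 {2}ab; apply: c_inj; rewrite -abw.
Qed.

Lemma GpointsV g : Gpoints c M g -> Gpoints c M g^-1%g.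
Proof.
move=> Mg.
have dY := definable_param Gpoints1 (definable_gmul_param hG (V := 'I_n + 'I_n) inl inr Mg).
have [|w gw Mw] := tarski_vaught hM dY.
  by exists (c g^-1%g); apply/(gmulE hG); rewrite mulgV.
have [b [wE /c_inj b1]] := (gmulVE hG _ _ _).1 gw.
by move=> i; move: (Mw i) (congr1 (@^~ i) wE); rewrite -b1 mulg1 => /= + wa; rewrite wa.
Qed.

(** The separation results speak of finite intersections of translates; [E] is the case of the
    single translate by 1, whose coordinates lie in [M]. *)
Let bigcap_ltrans1 : \bigcap_(j : 'I_1) ltrans_rel ((fun=> 1%g) j) E = E.
Proof.
apply/seteqP; split=> p; first by move=> /(_ ord0 Logic.I); rewrite ltrans_rel1.
by move=> Ep j _; rewrite ltrans_rel1.
Qed.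

Lemma Gclosed_rel_comp Z : Gdefinable_over c M Z -> Gclosed (rel_comp E Z).
Proof.
move=> dZ; split; last exact: rel_comp_idem.
have := tdefinable_rel_comp hN hM sM hG hphi (g := fun _ : 'I_1 => 1%g) sM
  (tdefinable_def dZ).
rewrite bigcap_ltrans1; apply: tdefinable_sub => x [[//|//]|[j [t ->]]].
exact: Gpoints1.
Qed.

(** An ultrafilter converges to the orbit of an element realizing all that eventually holds of
    representatives: if an open neighbourhood of that orbit were not in [F], the type-definable
    preimage of its complement would contain the element. *)
Lemma compact_quotient_types : compact [set: quotient_types c M E].
Proof.
rewrite compact_ultra => F UF _.
have /(_ _)/cid-/all_sig[r rK] := orbit_of_surj.
have [v vF] := @realize_filter _ _ _ hN 'I_n M _ F _ (fun o => c (r o)) sM.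
have [a _ aE] : range c v.
  apply: (vF _ (definable_in_G hG M id)); apply: filterS filterT => o _.
  by exists (r o).
exists (orbit_of c M E a); split=> // U.
rewrite nbhsE => -[V [oV Va] VU]; apply: filterS VU _.
have [//|FV] := in_ultra_setVsetC V UF; exfalso.
have [tV _] := closed_Gclosed (open_closedC oV).
suff : (orbit_of c M E @^-1` (~` V)) a by [].
apply: tV => Z dZ VZ; apply/(c_imageE hG); rewrite aE; apply: (vF _ dZ).
by apply: filterS FV => o Vo; exists (r o) => //; apply: VZ; rewrite /preimage /= rK.
Qed.

Lemma Gclosed_separation D D' : Gclosed D -> Gclosed D' -> D `&` D' = set0 ->
  exists Z Z', [/\ Gdefinable_over c M Z, Gdefinable_over c M Z', D `<=` Z,
    D' `<=` Z' & Z `&` Z' = set0].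
Proof.
move=> [tD ED] [tD' _] DD'.
have [|Z [Z' [B [[dZ DZ] [dZ' DZ'] eB BZ]]]] :=
  separation hN hM sM hG hphi (g := fun _ : 'I_1 => 1%g) sM sM tD tD'.
  by rewrite bigcap_ltrans1 ED.
(* The entourage contains the diagonal, so separated sets are disjoint. *)
exists Z, Z'; split=> //; rewrite -subset0 -BZ => x [Zx Z'x]; split=> //.
by exists x => //; apply: (entourage_sub eB); rewrite bigcap_ltrans1.
Qed.

Lemma normal_quotient_types (A B : set (quotient_types c M E)) :
  closed A -> closed B -> A `&` B = set0 ->
  exists U V, [/\ open U, open V, A `<=` U, B `<=` V & U `&` V = set0].
Proof.
move=> cA cB AB; have [|Z [Z' [dZ dZ' AZ BZ' ZZ']]] :=
  Gclosed_separation (closed_Gclosed cA) (closed_Gclosed cB).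
  by rewrite -preimage_setI AB preimage_set0.
(* [W Z] keeps only the orbits avoiding the saturation of the complement of [Z]; it is open because
   that saturation is closed. *)
pose W Z := ~` (orbit_of c M E @` rel_comp E (~` Z)).
have oW Y : Gdefinable_over c M Y -> open (W Y).
  by move=> dY; apply/closed_openC/closed_image/Gclosed_rel_comp/GdefinableC.
have subW (F : set (quotient_types c M E)) Y : closed F ->
    orbit_of c M E @^-1` F `<=` Y -> F `<=` W Y.
  move=> cF FY o Fo [a aY ao]; have [_ EF] := closed_Gclosed cF.
  have nE := rel_comp_subC eqE (Y := ~` Y) EF (fun b Fb nYb => nYb (FY b Fb)).
  by apply: (nE a) => //; rewrite /preimage /= ao.
have WY Y a : W Y (orbit_of c M E a) -> Y a.
  by move=> Wa; apply: contrapT => nYa; apply: Wa; exists a => //; exact: sub_rel_comp.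
exists (W Z), (W Z'); split; [exact: oW|exact: oW|exact: subW|exact: subW|].
rewrite -subset0 => o; have [a <-] := orbit_of_surj o.
by move=> [/WY Za /WY Z'a]; have : (Z `&` Z') a by []; rewrite ZZ'.
Qed.

(** Automorphisms over [M] fix [g], hence commute with translation by [g], and invariance of [E]
    makes the translate of a class a class. *)
Lemma orbit_of_ltrans g a : Gpoints c M g ->
  val (orbit_of c M E (g * a)%g) = [set ltrans g C | C in val (orbit_of c M E a)].
Proof.
move=> Mg.
have gE s b b' : automorphism_over M s -> c b' = s \o c b -> c (g * b')%g = s \o c (g * b)%g.
  move=> hs b'E; have [x xE] := tuple_in_G (g * b)%g hs; rewrite -xE.
  have gs : c g = s \o c g by apply/funext => i /=; have [_ ->] := hs.
  by rewrite (automorphism_mul hs gs b'E xE).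
have E_mulg b : eclass E (g * b)%g = ltrans g (eclass E b).
  apply/seteqP; split=> x; rewrite mem_ltrans /eclass /= => bx.
    by rewrite -[b](mulKg g); apply: invE => //; exact: GpointsV.
  by rewrite -[x](mulKVg g); exact: invE.
apply/seteqP; split=> [_ [s hs <-]|_ [_ [s hs <-] <-]];
    have [b bE] := tuple_in_G a hs; have gbE := gE _ _ _ hs bE.
  exists (aut_image c s (eclass E a)); first by exists s.
  by rewrite (aut_image_eclass hs bE) (aut_image_eclass hs gbE).
exists s => //.
by rewrite (aut_image_eclass hs bE) (aut_image_eclass hs gbE).
Qed.

Lemma orbit_of_mulg g a b : Gpoints c M g ->
  orbit_of c M E a = orbit_of c M E b -> orbit_of c M E (g * a)%g = orbit_of c M E (g * b)%g.
Proof. by move=> Mg ab; apply: val_inj; rewrite !orbit_of_ltrans// ab. Qed.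

Lemma act_typesE g B : Gpoints c M g ->
  orbit_of c M E @^-1` (act_types g B) = ltrans g (orbit_of c M E @^-1` B).
Proof.
move=> Mg; apply/seteqP; split=> a; rewrite mem_ltrans /preimage /=.
  move=> [q Bq]; have [b bq] := orbit_of_surj q.
  rewrite -{1}bq -orbit_of_ltrans// => /val_inj agb.
  suff -> : orbit_of c M E (g^-1 * a)%g = q by [].
  by rewrite (orbit_of_mulg (GpointsV Mg) agb) mulKg.
move=> Ba; exists (orbit_of c M E (g^-1 * a)%g) => //.
by rewrite -orbit_of_ltrans// mulKVg.
Qed.

End QuotientTopology.

(** * From means to measures *)

Section MeanToMeasure.
Context (L : language) (N : structure L) (K : Type) (hN : monster N K).
Context (M : set N) (hM : elementary_submodel M) (sM : small K M).
Context (n : nat) (G : groupType) (c : G -> 'I_n -> N) (hG : definable_group c).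
Context (d : Order.disp_t) (I : porderType d) (k : I -> nat).
Context (phi : forall i, formula L ('I_n + 'I_n + 'I_(k i))).
Hypothesis hphi : or_definable_family c phi.
Let E := family_rel c phi M.
Hypothesis eqE : equivalence_on_G E.
Hypothesis invE : rel_invariant (Gpoints c M) E.
Local Open Scope ring_scope.

Let X := quotient_types c M E.
Let orb := orbit_of c M E.

Lemma Gclosed_lattice D : Gclosed M c phi D -> D_lattice c phi K M D.
Proof.
move=> [tD ED]; split; first by apply/Gtype_definableP; exists M.
exists 0%N, (fun=> 1%g); rewrite (_ : \bigcap_j _ = E)//.
apply/seteqP; split=> p; first by move=> /(_ ord0 Logic.I); rewrite ltrans_rel1.
by move=> Ep j _; rewrite ltrans_rel1.
Qed.

Lemma closed_act_types g (C : set X) : Gpoints c M g -> closed C -> closed (act_types g C).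
Proof.
move=> Mg /(closed_Gclosed hN hM sM hG eqE)[tC _].
apply: (tdefinable_closed hN sM hG); rewrite (act_typesE hM hG invE C Mg).
move=> x Hx; rewrite mem_ltrans; apply: tC => Z dZ CZ; rewrite -mem_ltrans.
apply: Hx; first exact: Gdefinable_ltrans.
by move=> y; rewrite !mem_ltrans; exact: CZ.
Qed.

Lemma mean_to_measure (R : realType) (rho : set G -> R) :
  normalized_mean (D_lattice c phi K M) rho ->
  left_invariant (Gpoints c M) (D_lattice c phi K M) rho ->
  exists mu : probability (borel_quotient_types c M E) R, invariant_probability mu.
Proof.
move=> [_ rmono [r0 r1] rmod] rinv.
have lat (F : set X) : closed F -> D_lattice c phi K M (orb @^-1` F).
  by move=> cF; exact/Gclosed_lattice/(closed_Gclosed hN hM sM hG eqE).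
pose r (F : set X) : R := rho (orb @^-1` F).
have r_mono C D : closed C -> closed D -> C `<=` D -> r C <= r D.
  by move=> cC cD CD; apply: rmono; [exact: lat|exact: lat|exact: preimage_subset].
have r_ge0 C : closed C -> 0 <= r C.
  by move=> cC; rewrite -r0 -(preimage_set0 orb); apply: r_mono => //; exact: closed0.
have r_mod C D : closed C -> closed D -> r (C `|` D) = r C + r D - r (C `&` D).
  by move=> cC cD; rewrite /r preimage_setU preimage_setI; apply: rmod; exact: lat.
have [| | | | |mu muE] := content_probability (rho := r)
  (@compact_quotient_types _ _ _ hN _ hM sM _ _ _ hG _ _ _ _ eqE)
  (@normal_quotient_types _ _ _ hN _ hM sM _ _ _ hG _ _ _ _ hphi eqE).
- by rewrite /r preimage_set0.
- by rewrite /r preimage_setT.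
- exact: r_mono.
- by move=> C D cC cD; rewrite r_mod// gerBl r_ge0//; exact: closedI.
- by move=> C D cC cD CD; rewrite r_mod// CD /r preimage_set0 r0 subr0.
have /(_ _)/cid-/all_sig[rep repK] := @orbit_of_surj _ _ M _ _ c _ _ _ phi.
have mulg_orb g a b : Gpoints c M g -> orb a = orb b -> orb (g * a)%g = orb (g * b)%g.
  exact: orbit_of_mulg.
(* The action on sets is the image under a bijection of the quotient, independent of the
   representatives, so that [outer_content_image] applies. *)
pose h g (q : X) : X := orb (g * rep q)%g.
have hV g : Gpoints c M g -> Gpoints c M g^-1%g by exact: GpointsV.
have hK g : Gpoints c M g -> cancel (h g) (h g^-1%g).
  by move=> Mg q; rewrite /h (mulg_orb _ _ _ (hV _ Mg) (repK _)) mulKg; exact: repK.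
have hVK g : Gpoints c M g -> cancel (h g^-1%g) (h g).
  by move=> Mg; rewrite -{2}[g]invgK; apply: hK; exact: hV.
have actE g (C : set X) : Gpoints c M g -> act_types g C = h g @` C.
  move=> Mg; apply/seteqP.
  have mem_act a : act_types g C (orb a) <-> C (orb (g^-1 * a)%g).
    suff -> : act_types g C (orb a) = ltrans g (orb @^-1` C) a by exact: mem_ltrans.
    by rewrite -(act_typesE hM hG invE C Mg).
  split=> q; have [a <-] := orbit_of_surj q.
    move=> /mem_act Ca; exists (orb (g^-1 * a)%g) => //.
    by rewrite /h (mulg_orb _ _ _ Mg (repK _)) mulKVg.
  move=> [q' Cq' q'a]; apply/mem_act.
  suff -> : orb (g^-1 * a)%g = q' by [].
  rewrite -(repK q') -(mulKg g (rep q')).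
  exact: mulg_orb (hV _ Mg) (esym q'a).
have act_le g (B : set X) : Gpoints c M g ->
    (outer_content r (act_types g B) <= outer_content r B)%E.
  move=> Mg; rewrite actE//; apply: (outer_content_image _ (hK g Mg) (hVK g Mg)) => C cC.
  - by rewrite -actE//; exact: closed_act_types.
  - by rewrite -actE; [apply: closed_act_types => //|]; exact: hV.
  - rewrite -actE; last exact: hV.
    rewrite /r /orb act_typesE//; last exact: hV.
    by apply: rinv; [exact: hV|exact: lat].
exists mu => g B Mg _; apply/eqP; rewrite eq_le !muE act_le//=.
suff {1}-> : B = act_types g^-1%g (act_types g B) by apply: act_le; exact: hV.
rewrite !actE//; last exact: hV.
by rewrite image_comp (_ : _ \o _ = id) ?image_id//; apply/funext; exact: hK.
Qed.

End MeanToMeasure.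

(** * From measures to pre-means *)

Section UltraLimit.
Context (R : realType) (T : Type) (U : set_system T) (UU : UltraFilter U).
Local Open Scope ring_scope.

Lemma ultra_cvg (f : T -> R) : (\forall s \near U, 0 <= f s <= 1) -> cvg (f @ U).
Proof.
move=> f01.
have fU : UltraFilter (f @ U).
  split; first exact: fmap_proper_filter.
  move=> H PH sub; apply/seteqP; split; last exact: sub.
  move=> B HB; have [//|UB] := in_ultra_setVsetC (f @^-1` B) UU.
  have HnB : H (~` B) by exact: sub.
  by have /filter_ex[x []] : H (B `&` ~` B) by exact: filterI.
have := @segment_compact R 0 1; rewrite compact_ultra => /(_ (f @ U) fU)[|l [_ fl]].
  by apply: filterS f01 => s; rewrite /= in_itv.
by apply/cvg_ex; exists l.
Qed.

Lemma ultra_ler_cvg (f g : T -> R) (l l' : R) : f @ U --> l -> g @ U --> l' ->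
  (\forall s \near U, f s <= g s) -> l <= l'.
Proof.
move=> fl gl fg; rewrite -subr_ge0.
apply: (closed_cvg _ (@closed_ge R 0) _ _ (cvgB gl fl)).
by apply: filterS fg => s; rewrite /= !fctE subr_ge0.
Qed.

End UltraLimit.

Section Specializations.
Context (L : language) (N : structure L).
Context (M : set N) (hM : elementary_submodel M).

(* By Tarski-Vaught, any first-order property of elements of [N] also holds
   after moving these elements into [M] by a suitable [s : N -> M] that fixes
   [M]; along the following ultrafilter all these properties hold eventually. *)
Lemma specialization_ultrafilter : exists U : set_system (N -> N),
  [/\ UltraFilter U, \forall s \near U, forall x, M (s x),
      \forall s \near U, forall x, M x -> s x = x &
      forall P : set (N -> N), definable set0 P -> P id -> \forall s \near U, P s].
Proof.
pose F := filter_from (fun P : set (N -> N) => definable set0 P /\ P id)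
  (fun P => [set s | [/\ P s, forall x, M (s x) & forall x, M x -> s x = x]]).
have FF : ProperFilter F.
  apply: filter_from_proper; last first.
    by move=> P [dP Pid]; have [s Ps] := specialization hM dP Pid; exists s.
  apply: filter_from_filter; first by exists setT; split=> //; exact: definableT.
  move=> P Q [dP Pid] [dQ Qid]; exists (P `&` Q); first by split=> //; exact: definable_and.
  by move=> s [[]].
have [U [UU FU]] := ultraFilterLemma FF; exists U; split=> //.
- by apply: FU; exists setT; [split=> //; exact: definableT|move=> s []].
- by apply: FU; exists setT; [split=> //; exact: definableT|move=> s []].
- by move=> P dP Pid; apply: FU; exists P => // s [].
Qed.

End Specializations.

Section MeasureToPreMean.
Context (L : language) (N : structure L) (K : Type) (hN : monster N K).
Context (M : set N) (hM : elementary_submodel M) (sM : small K M).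
Context (n : nat) (G : groupType) (c : G -> 'I_n -> N) (hG : definable_group c).
Context (d : Order.disp_t) (I : porderType d) (k : I -> nat).
Context (phi : forall i, formula L ('I_n + 'I_n + 'I_(k i))).
Hypothesis hphi : or_definable_family c phi.
Let E := family_rel c phi M.
Hypothesis eqE : equivalence_on_G E.
Hypothesis invE : rel_invariant (Gpoints c M) E.
Context (R : realType) (mu : probability (borel_quotient_types c M E) R).
Hypothesis invmu : invariant_probability mu.
Local Open Scope ring_scope.

Let X := quotient_types c M E.
Let orb := orbit_of c M E.
Let MdefZ := Gdefinable_over c M.

Definition model_mean (Z : set G) : R := fine (mu (orb @` Z)).

Lemma measurable_orb Z : MdefZ Z -> measurable (orb @` Z : set (borel_quotient_types c M E)).
Proof.
move=> dZ.
(* The image of [Z] is also that of its saturation, which is closed. *)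
suff -> : orb @` Z = orb @` (rel_comp E Z).
  rewrite -[X in measurable X]setCK; apply: measurableC; apply: sub_sigma_algebra.
  apply/closed_openC/(closed_image hN sM hG eqE).
  exact: (Gclosed_rel_comp hN hM sM hG hphi eqE).
apply/seteqP; split=> _ [a Za <-].
  by exists a => //; exact: sub_rel_comp.
by have [b Zb ba] := Za; exists b => //; exact: (orbit_of_rel hG eqE ba).
Qed.

Let muE Z : MdefZ Z -> mu (orb @` Z) = (model_mean Z)%:E.
Proof. by move=> dZ; rewrite /model_mean fineK// fin_num_measure//; exact: measurable_orb. Qed.

Lemma model_mean01 Z : MdefZ Z -> 0 <= model_mean Z <= 1.
Proof.
move=> dZ; rewrite -!lee_fin -muE// measure_ge0/=.
by apply: probability_le1; exact: measurable_orb.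
Qed.

Lemma model_mean_mono Z Z' : MdefZ Z -> MdefZ Z' -> Z `<=` Z' ->
  model_mean Z <= model_mean Z'.
Proof.
move=> dZ dZ' ZZ'; rewrite -lee_fin -!muE//.
by apply: le_measure; rewrite ?inE; [exact: measurable_orb..|exact: image_subset].
Qed.

Lemma model_mean0 : model_mean set0 = 0.
Proof. by rewrite /model_mean image_set0 measure0. Qed.

Lemma model_meanT : model_mean setT = 1.
Proof.
rewrite /model_mean (_ : orb @` setT = setT) ?probability_setT//.
by apply/seteqP; split=> // q _; have [a <-] := orbit_of_surj q; exists a.
Qed.

Lemma model_meanU Z Z' : MdefZ Z -> MdefZ Z' ->
  model_mean (Z `|` Z') <= model_mean Z + model_mean Z'.
Proof.
move=> dZ dZ'; have dU := GdefinableU hG dZ dZ'.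
rewrite -lee_fin EFinD -!muE// image_setU.
by apply: measureU2; exact: measurable_orb.
Qed.

(** If the images met, an automorphism over [M], which preserves [Z], would move a point of [Z] to
    one related by [E] to a point of [Z']. *)
Lemma model_mean_add Z Z' : MdefZ Z -> MdefZ Z' -> rel_comp E Z `&` Z' = set0 ->
  model_mean (Z `|` Z') = model_mean Z + model_mean Z'.
Proof.
move=> dZ dZ' ZZ'; have dU := GdefinableU hG dZ dZ'.
apply: EFin_inj; rewrite EFinD -!muE// image_setU.
rewrite measureU//; [exact: measurable_orb|exact: measurable_orb|].
rewrite -subset0 => _ [[a Za <-] [b Z'b ba]].
have [s [a' [hs a'E ba']]] := (orbit_ofP hG eqE b a).1 ba.
have Za' : Z a' by apply/(automorphism_Gdefinable hG hs dZ a'E).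
have [_ Es _] := eqE.
have : (rel_comp E Z `&` Z') b by split=> //; exists a' => //; exact: Es.
by rewrite ZZ'.
Qed.

Lemma model_mean_ltrans g Z : Gpoints c M g -> MdefZ Z ->
  model_mean (ltrans g Z) = model_mean Z.
Proof.
move=> Mg dZ; rewrite /model_mean; congr fine.
rewrite -(invmu Mg (measurable_orb dZ)); congr (mu _).
apply/seteqP; split=> q; have [a <-] := orbit_of_surj q.
  move=> [_ [b Zb <-] <-]; exists (orb b); first by exists b.
  by rewrite -(orbit_of_ltrans hM hG invE).
move=> [_ [b Zb <-]]; rewrite -(orbit_of_ltrans hM hG invE)// => /val_inj ->.
by exists (g * b)%g => //; exists b.
Qed.

Lemma definable_allG A V (Y : set (V + 'I_n -> N)) : definable A Y ->
  definable A [set v : V -> N | forall a, Y (vjoin v (c a))].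
Proof.
move=> dY.
apply: definable_eq (definable_all (definable_imp (definable_in_G hG A inr) dY)) => v.
split=> [H a|H w [a _ aw]]; first by apply: H; exists a.
by have {aw}aw : c a = w := aw; rewrite -aw.
Qed.

(** All parameters become variables indexed by [N], so that maps [s : N -> N] can move them. *)
Lemma code_exists (Y : set G) : exists psi : formula L ('I_n + N),
  Gdefinable c Y -> forall a, Y a <-> sat psi (vjoin (c a) id).
Proof.
have [dY|ndY] := pselect (Gdefinable c Y); last by exists (Bot L _).
have [psi psiE] := (definableP _ _).1 dY.
exists (rename psi (fun x => match x with inl t => inl t | inr y => inr (val y) end)).
move=> _ a; rewrite sat_rename.
rewrite (_ : _ \o _ = vjoin (c a) val); last by apply/funext => -[].
by apply: iff_trans (psiE _); exact: iff_sym (c_imageE hG _ _).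
Qed.

Let code Y := sval (cid (code_exists Y)).

Let codeE Y : Gdefinable c Y -> forall a, Y a <-> sat (code Y) (vjoin (c a) id).
Proof. exact: svalP (cid (code_exists Y)). Qed.

Let spec (s : N -> N) (Y : set G) : set G := [set a | sat (code Y) (vjoin (c a) s)].

Let Mdef_spec s Y : (forall x, M (s x)) -> MdefZ (spec s Y).
Proof.
move=> Ms; have := definable_param Ms (definable_sat M (code Y) id).
by apply: (Gdefinable_overP hG) => a.
Qed.

Let definable_spec A V (f : 'I_n -> V) (h : N -> V) Y : definable A [set u : V -> N |
  sat (code Y) (vjoin (fun t => u (f t)) (fun x => u (h x)))].
Proof.
apply: definable_eq (definable_sat A (code Y)
  (fun x => match x with inl t => f t | inr y => h y end)) => u /=.
suff -> : (fun x => u (match x with inl t => f t | inr y => h y end)) =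
  vjoin (fun t => u (f t)) (fun x => u (h x)) by [].
by apply/funext => -[].
Qed.

(** The formulas [code Y] are chosen independently for different [Y]. Inclusions, unions and
    translations between the sets are first-order properties of the parameters, true at [id], so
    they hold eventually for the moved sets, which is all that the limit sees. *)
Lemma measure_to_pre_mean : exists2 m : set G -> R, G_pre_mean c phi M m &
  left_invariant [set: G] (Gdefinable c) m.
Proof.
have [U [UU UM Ufix Ulos]] := specialization_ultrafilter hM.
pose m Y : R := lim ((fun s => model_mean (spec s Y)) @ U).
have allG (Q : set (N + 'I_n -> N)) : definable set0 Q ->
    (forall a, Q (vjoin id (c a))) -> \forall s \near U, forall a, Q (vjoin s (c a)).
  by move=> dQ Qid; apply: Ulos => //; exact: definable_allG.
pose memQ Y (u : N + 'I_n -> N) :=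
  sat (code Y) (vjoin (fun t => u (inr t)) (fun x => u (inl x))).
have dQ Y : definable set0 (memQ Y) by exact: definable_spec.
have UMdef Y : \forall s \near U, MdefZ (spec s Y).
  by apply: filterS UM => s; exact: Mdef_spec.
have cvgm Y : (fun s => model_mean (spec s Y)) @ U --> m Y.
  by apply: ultra_cvg; apply: filterS (UMdef Y) => s; exact: model_mean01.
have cstR (x : R) : (fun _ : N -> N => x) @ U --> x by exact: cvg_cst.
have Usub Y Y' : Gdefinable c Y -> Gdefinable c Y' -> Y `<=` Y' ->
    \forall s \near U, spec s Y `<=` spec s Y'.
  move=> dY dY' YY'; apply: filterS (allG _ (definable_imp (dQ Y) (dQ Y')) _).
    by move=> s H a; exact: H.
  by move=> a /(codeE dY)/YY'/(codeE dY').
have Uset0 : \forall s \near U, spec s set0 = set0.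
  apply: filterS (allG _ (definable_not (dQ set0)) _).
    by move=> s H; rewrite -subset0 => a; exact: H.
  by move=> a /(codeE (Gdefinable0 hG _)).
have UsetT : \forall s \near U, spec s setT = setT.
  apply: filterS (allG _ (dQ setT) _) => [s H|a].
    by apply/seteqP; split=> a _ //; exact: H.
  exact/(codeE (GdefinableT hG _)).
have UsetU Y Y' : Gdefinable c Y -> Gdefinable c Y' ->
    \forall s \near U, spec s (Y `|` Y') = spec s Y `|` spec s Y'.
  move=> dY dY'; have dYY' := GdefinableU hG dY dY'.
  apply: filterS (allG _ (definable_iff (dQ (Y `|` Y')) (definable_or (dQ Y) (dQ Y'))) _).
    by move=> s H; apply/seteqP; split=> a /H.
  move=> a; split=> [/(codeE dYY')[/(codeE dY)|/(codeE dY')]|]; [by left|by right|].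
  by move=> Ya; apply/(codeE dYY'); case: Ya => [/(codeE dY)|/(codeE dY')]; [left|right].
have Ug g : \forall s \near U, exists2 g', Gpoints c M g' & c g' = s \o c g.
  have := Ulos _ (definable_in_G hG set0 (c g)).
  move=> /(_ (ex_intro2 _ _ g Logic.I erefl)) UG; apply: filterS2 UM UG => s Ms [g' _ g'E].
  by exists g' => // i; rewrite g'E.
have eqm Y (f : (N -> N) -> R) (l : R) : f @ U --> l ->
    (\forall s \near U, model_mean (spec s Y) = f s) -> m Y = l.
  move=> fl Yf; apply/eqP; rewrite eq_le.
  apply/andP; split; [apply: ultra_ler_cvg (cvgm Y) fl _|apply: ultra_ler_cvg fl (cvgm Y) _];
    by apply: filterS Yf => s ->.
exists m; first split.
- move=> Y dY; apply/andP; split.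
    apply: ultra_ler_cvg (cstR 0) (cvgm Y) _.
    by apply: filterS (UMdef Y) => s /model_mean01/andP[].
  apply: ultra_ler_cvg (cvgm Y) (cstR 1) _.
  by apply: filterS (UMdef Y) => s /model_mean01/andP[].
- move=> Y Y' dY dY' YY'; apply: ultra_ler_cvg (cvgm Y) (cvgm Y') _.
  by apply: filterS3 (UMdef Y) (UMdef Y') (Usub _ _ dY dY' YY') => s; exact: model_mean_mono.
- split; first by apply: eqm (cstR 0) _; apply: filterS Uset0 => s ->; exact: model_mean0.
  by apply: eqm (cstR 1) _; apply: filterS UsetT => s ->; exact: model_meanT.
- move=> Y Y' dY dY'; apply: ultra_ler_cvg (cvgm _) (cvgD (cvgm Y) (cvgm Y')) _.
  apply: filterS3 (UMdef Y) (UMdef Y') (UsetU _ _ dY dY') => s sY sY' ->.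
  exact: model_meanU.
- move=> Y Y' dY dY' [r [g [i [b [Mb YY']]]]].
  apply: eqm (cvgD (cvgm Y) (cvgm Y')) _.
  (* [Q] says that a point of [Y] and a point of [Y'] are related by all the translates; the
     hypothesis refutes it at [id], hence eventually. *)
  pose Q (u : N + 'I_n + 'I_n -> N) :=
    (sat (code Y) (vjoin (fun t => u (inl (inr t))) (fun x => u (inl (inl x)))) /\
     sat (code Y') (vjoin (fun t => u (inr t)) (fun x => u (inl (inl x))))) /\
    forall j, ltrans_formula c phi (fun t => u (inl (inl (c (g j) t))))
      (fun t => u (inl (inl (b j t)))) (fun t => u (inl (inr t))) (fun t => u (inr t)).
  have dQ2 : definable set0 [set u | ~ Q u].
    apply/definable_not/definable_and; first by apply: definable_and; exact: definable_spec.
    by apply: definable_forall_fin => j; exact: definable_ltrans_formula.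
  have Qid : forall y x, ~ Q (vjoin (vjoin id (c y)) (c x)).
    move=> y x [[/(codeE dY) Yy /(codeE dY') Y'x] H].
    rewrite -[False]/(set0 x) -YY'; split=> //; exists y => // j _.
    by apply/(ltrans_formulaE hG); exact: (H j).
  have UQ := Ulos _ (definable_allG (definable_allG dQ2)) Qid.
  have Ugj : \forall s \near U, forall j, exists2 g', Gpoints c M g' & c g' = s \o c (g j).
    suff H (q : seq 'I_r.+1) : \forall s \near U, forall j, j \in q ->
        exists2 g', Gpoints c M g' & c g' = s \o c (g j).
      by apply: filterS (H (enum 'I_r.+1)) => s Hs j; apply: Hs; rewrite mem_enum.
    elim: q => [|j q IH]; first exact: nearW.
    by apply: filterS2 (Ug (g j)) IH => s sj sq j'; rewrite in_cons => /orP[/eqP->|/sq].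
  have UY := UMdef Y; have UY' := UMdef Y'; have UYY' := UsetU _ _ dY dY'.
  apply: filterS3 (filterI UQ Ugj) (filterI UY UY') (filterI UYY' Ufix).
  move=> s [sQ sg] [sY sY'] [-> sfix]; apply: model_mean_add => //.
  rewrite -subset0 => x [[y Yy yx] Y'x]; apply: (sQ y x); split=> // j.
  have [g' Mg' g'E] := sg j.
  suff : ltrans_formula c phi (s \o c (g j)) (s \o b j) (c y) (c x) by [].
  rewrite -g'E (_ : s \o b j = b j); last by apply/funext => t /=; rewrite sfix.
  apply/(ltrans_formulaE hG)/ltrans_relE => /=.
  (* As [g'] lies in [G(M)], a pair in [E] stays in [E] after translation back by [g'], so it
     satisfies the instance with parameters [b j] from [M]. *)
  have := invE (GpointsV hM hG Mg') yx; apply; exact: Mb.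
- move=> g Y _ dY; apply: eqm (cvgm Y) _.
  have dgY : Gdefinable c (ltrans g Y) by exact: Gdefinable_ltrans.
  (* Eventually the moved set of the translate is the translate of the moved set by [g'] in [G(M)],
     under which [model_mean] is invariant. *)
  pose Q (u : N + 'I_n + 'I_n -> N) :=
    gmul c (fun t => u (inl (inl (c g t)))) (fun t => u (inl (inr t))) (fun t => u (inr t)) ->
    (sat (code (ltrans g Y)) (vjoin (fun t => u (inr t)) (fun x => u (inl (inl x)))) <->
     sat (code Y) (vjoin (fun t => u (inl (inr t))) (fun x => u (inl (inl x))))).
  have dQ2 : definable set0 Q.
    apply: definable_imp; first exact: definable_gmul.
    by apply: definable_iff; exact: definable_spec.
  have Qid : forall b a, Q (vjoin (vjoin id (c b)) (c a)).
    move=> b a gba; apply: iff_trans (iff_sym (codeE dgY _)) _.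
    apply: iff_trans (codeE dY _); rewrite mem_ltrans.
    have [c_inj _ _] := hG.
    by have /(gmulE hG)/c_inj -> : gmul c (c g) (c b) (c a) := gba; rewrite mulKg.
  have UQ := Ulos _ (definable_allG (definable_allG dQ2)) Qid.
  apply: filterS3 UQ (Ug g) (UMdef Y) => s sQ [g' Mg' g'E] sY.
  rewrite -(model_mean_ltrans Mg' sY); congr model_mean.
  have key a : spec s (ltrans g Y) a <-> spec s Y (g'^-1 * a)%g.
    apply: (sQ (g'^-1 * a)%g a).
    suff : gmul c (s \o c g) (c (g'^-1 * a)%g) (c a) by [].
    by rewrite -g'E; apply/(gmulE hG); rewrite mulKVg.
  by apply/seteqP; split=> a => [/key ga|/mem_ltrans ga]; [apply/mem_ltrans|apply/key].
Qed.

End MeasureToPreMean.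

Theorem proposition3p30 (R : realType) (K : Type)
    (L : language) (N : structure L) (hN : monster N K)
    (M : set N) (hM : elementary_submodel M) (sM : small K M)
    (n : nat) (G : groupType) (c : G -> 'I_n -> N) (hG : definable_group c)
    (d : Order.disp_t) (I : porderType d) (k : I -> nat)
    (phi : forall i, formula L ('I_n + 'I_n + 'I_(k i)))
    (hphi : or_definable_family c phi)
    (hE : defines_equivalence c phi K)
    (invE : rel_invariant (Gpoints c M) (family_rel c phi M)) :
  [<-> exists mu : probability (borel_quotient_types c M (family_rel c phi M)) R,
         invariant_probability mu;
       exists2 m : set G -> R, G_pre_mean c phi M m &
         left_invariant (Gpoints c M) (Gdefinable c) m;
       exists2 m : set G -> R, G_pre_mean c phi M m &
         left_invariant [set: G] (Gdefinable c) m;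
       exists2 rho : set G -> R, normalized_mean (D_lattice c phi K M) rho &
         left_invariant (Gpoints c M) (D_lattice c phi K M) rho;
       exists2 rho : set G -> R, normalized_mean (D_lattice c phi K M) rho &
         left_invariant [set: G] (D_lattice c phi K M) rho].
Proof.
have eqE := hE M hM sM.
pose pre_mean H := exists2 m : set G -> R, G_pre_mean c phi M m &
  left_invariant H (Gdefinable c) m.
pose mean H := exists2 rho : set G -> R, normalized_mean (D_lattice c phi K M) rho &
  left_invariant H (D_lattice c phi K M) rho.
have setT_sub (P : (set G -> R) -> Prop) (Lat : set (set G)) :
    (exists2 m, P m & left_invariant [set: G] Lat m) ->
    exists2 m, P m & left_invariant (Gpoints c M) Lat m.
  by move=> [m Pm mG]; exists m => // g Y _; exact: mG.
have pre_mean_mean H : pre_mean H -> mean H.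
  move=> [m hm mH]; exists (outer_mean c m).
    exact: (normalized_outer_mean hN hM sM hG hphi eqE hm).
  exact: (outer_mean_ltrans hG hm mH).
(* Invariance improves from [G(M)] to [G] on the way through the measure. *)
have mean_pre_mean : mean (Gpoints c M) -> pre_mean [set: G].
  move=> [rho hrho rhoM].
  have [mu invmu] := mean_to_measure hN hM sM hG hphi eqE invE hrho rhoM.
  exact: (measure_to_pre_mean hN hM sM hG hphi eqE invE invmu).
tfae.
- move=> [mu invmu]; apply: setT_sub.
  exact: (measure_to_pre_mean hN hM sM hG hphi eqE invE invmu).
- by move=> /pre_mean_mean/mean_pre_mean.
- by move=> /pre_mean_mean/setT_sub.
- by move=> /mean_pre_mean/pre_mean_mean.
- move=> /setT_sub[rho hrho rhoM].
  exact: (mean_to_measure hN hM sM hG hphi eqE invE hrho rhoM).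
Qed.
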